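(* Let $A$ be a formula of TCF with free term variables exactly $\vec x=x_0,\dots,x_{n-1}$, $n>0$, and for each $i<n$ let $C_i$ be a formula whose only free term variable is $x_i$; write $\vec C\to B$ for $C_0\to\dots\to C_{n-1}\to B$. Assume $\mathbf{PP}(A)=\emptyset$. Then: (1) if $\vdash\forall_{\vec x}(\vec C\to A\vee A^{\mathbf N})$, then $A$ is tight relative to $\vec C$, i.e. $\vdash\forall_{\vec x}(\vec C\to\neg(A^{\mathbf N})\to A)$; (2) if $A$ is tight relative to $\vec C$, then $\vdash\forall_{\vec x}(\vec C\to\neg\neg A\to A)$; (3) if $A$ is tight relative to $\vec C$, then the formula $\forall_{\vec x}(\vec C\to A)$ is tight, i.e. $\vdash\neg\big((\forall_{\vec x}(\vec C\to A))^{\mathbf N}\big)\to\forall_{\vec x}(\vec C\to A)$.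
   Context: **Types and terms of TCF.** Types are $\rho,\sigma::=\alpha\mid\rho\to\sigma\mid\iota$, with $\alpha$ type variables and $\iota=\langle C_i:\vec\rho_i[\beta/\iota]\to\iota\rangle_{i<k}$ free algebras given by constructors, $\beta$ occurring at most strictly positively in each argument type; e.g. the booleans $\mathbb B$ with constructors $\mathtt f,\mathtt t$. Terms are simply typed: $t,s::=x^\rho\mid\lambda_xt\mid ts\mid C_i\mid D$ ($C_i$ constructors), where $D$ ranges over program constants introduced by finitely many computation rules $D\vec P_i:=t_i$ with $\vec P_i$ constructor patterns (built from variables and constructors), non-unifiable for different $i$. Computation need not terminate (terms are partial). Terms are identified up to renaming, $\beta$-equality and computation rules. **Formulas and predicates** are defined simultaneously by $$P::=X\mid\{\vec x\mid A\}\mid\mu_X\vec K\mid\nu_X\vec K,\qquad A,B::=P\vec t\mid A\to B\mid A\wedge B\mid A\vee B\mid\forall_xA\mid\exists_xA,$$ with $X$ predicate variables with arities (lists of types), $\vec x$ in $\{\vec x\mid A\}$ exactly the free term variables of $A$, and $\{\vec x\mid A\}\vec y$ identified with $A[\vec x/\vec y]$. $\vec K$ is a finite list of clauses $K_i=\forall_{\vec x_i}(A_{i0}(X)\to\dots\to A_{i,n_i-1}(X)\to X\vec t_i)$, $i<k$, without free term variables, where $X$ occurs at most strictly positively in each premise $A_{i\nu}$ (never free to the left of an implication, including inside the clauses of nested predicates). $\mu_X\vec K$ is an inductive, $\nu_X\vec K$ a coinductive predicate. Put $P\cap Q=\{\vec x\mid P\vec x\wedge Q\vec x\}$, $P\cup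 Q=\{\vec x\mid P\vec x\vee Q\vec x\}$, $P\subseteq Q:=\forall_{\vec x}(P\vec x\to Q\vec x)$. **Derivations.** Minimal natural deduction with the usual introduction and elimination axioms for $\wedge,\vee,\exists$, and the following axioms. For $I=\mu_X\vec K$: $\forall_{\vec x_i}(\vec A_i(I)\to I\vec t_i)$ for $i<k$, and for every predicate $P$ the induction axiom $\big(\forall_{\vec x_i}(\vec A_i(I\cap P)\to P\vec t_i)\big)_{i<k}\to I\subseteq P$. For $J=\nu_X\vec K$, with $\Phi(X)=\{\vec y\mid\bigvee_{i<k}\exists_{\vec x_i}(\vec y\equiv\vec t_i\wedge\bigwedge\vec A_i(X))\}$: $J\subseteq\Phi(J)$, and for every predicate $Q$, $Q\subseteq\Phi(J\cup Q)\to Q\subseteq J$. Leibniz equality is $\equiv\,:=\mu_X(\forall_xXxx)$; $\vec x\equiv\vec y$ is the componentwise conjunction; $\bot:=(\mathtt f\equiv\mathtt t)$; $\neg A:=A\to\bot$. $\vdash A$ means $A$ is derivable. **Standing restriction.** Inductive predicates are assumed to be inhabited: $I$ is inhabited if there are terms $\vec t$ with $I\vec t$; in particular this is the case when $I=\mu_X\vec K$ has a clause in none of whose premises $X$ occurs freely. **Strong negation.** To each predicate variable $X$ are assigned new distinct predicate variables $X',X'',\dots$ of the same arity, with $(X^{(n)})'=X^{(n+1)}$ and $X^{(n)}\ne Y^{(m)}$ if $X\neq Y$. Define $(P\vec t)^{\mathbf N}=P^{\mathbf N}\vec t$, $(A\to B)^{\mathbf N}=A\wedge B^{\mathbf N}$,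 $(A\wedge B)^{\mathbf N}=A^{\mathbf N}\vee B^{\mathbf N}$, $(A\vee B)^{\mathbf N}=A^{\mathbf N}\wedge B^{\mathbf N}$, $(\forall_xA)^{\mathbf N}=\exists_xA^{\mathbf N}$, $(\exists_xA)^{\mathbf N}=\forall_xA^{\mathbf N}$, $X^{\mathbf N}=X'$, $\{\vec x\mid A\}^{\mathbf N}=\{\vec x\mid A^{\mathbf N}\}$. For a finite list of clauses $\vec K=\big(\forall_{\vec x_i}(A_{i0}(X)\to\dots\to A_{i,n_i-1}(X)\to X\vec t_i)\big)_{i<k}$ without free term variables, with $X$ at most strictly positive in each premise $A_{i\nu}$, let $E(X')(\vec y):=\bigwedge_{i<k}\forall_{\vec x_i}(\vec y\equiv\vec t_i\to B_i)$, where $B_i:=\bigvee_{\nu<n_i}A_{i\nu}^{\mathbf N}$ if $n_i>0$ and $B_i:=\bot$ if $n_i=0$. Then $(\mu_X\vec K)^{\mathbf N}$ is the greatest fixed point $\nu_{X'}\big(\forall_{\vec y}(X'\vec y\to E(X')(\vec y))\big)$ (i.e. the coinductive predicate with the single clause $\forall_{\vec y}(E(X')(\vec y)\to X'\vec y)$), and $(\nu_X\vec K)^{\mathbf N}$ is the inductive predicate $\mu_{X'}\big(\forall_{\vec y}(E(X')(\vec y)\to X'\vec y)\big)$. **Strictly positive free predicate variables** $\mathbf{PP}$: $\mathbf{PP}(X)=\{X\}$, $\mathbf{PP}(A\to B)=\mathbf{PP}(B)$, $\mathbf{PP}(A\wedge B)=\mathbf{PP}(A\vee B)=\mathbf{PP}(A)\cup\mathbf{PP}(B)$,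 $\mathbf{PP}(\forall_xA)=\mathbf{PP}(\exists_xA)=\mathbf{PP}(\{\vec x\mid A\})=\mathbf{PP}(A)$, $\mathbf{PP}(P\vec t)=\mathbf{PP}(P)$, and for $\mu_X\vec K$ and $\nu_X\vec K$ it is $\bigcup_{i,\nu}\mathbf{PP}(A_{i\nu})\setminus\{X\}$. *)

(* Defs.v *)
From Stdlib Require List.
From mathcomp Require Import all_boot.

Set Implicit Arguments.
Unset Strict Implicit.
Unset Printing Implicit Defensive.

(* Syntax is intrinsically scoped and typed: a term variable, a bound predicate
   variable, a constructor of an algebra are all typed de Bruijn indices into a
   sequence, position 0 being the head (the innermost binder). *)
Inductive ix {S : Type} : seq S -> S -> Type :=
| ix0 s x : ix (x :: s) x
| ixS s x y : ix s x -> ix (y :: s) x.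
Arguments ix0 {S s x}.
Arguments ixS {S s x} y _.

Fixpoint pos {S : Type} (s : seq S) x (i : ix s x) : nat :=
  match i with ix0 _ _ => 0 | ixS _ _ _ j => (pos j).+1 end.

Fixpoint ixl {S : Type} (s1 s2 : seq S) x (i : ix s1 x) : ix (s1 ++ s2) x :=
  match i in ix s x return ix (s ++ s2) x with
  | ix0 _ _ => ix0
  | ixS _ _ y j => ixS y (ixl s2 j)
  end.

Fixpoint ixr {S : Type} (s1 s2 : seq S) x (i : ix s2 x) : ix (s1 ++ s2) x :=
  match s1 return ix (s1 ++ s2) x with
  | [::] => i
  | y :: s1' => ixS y (ixr s1' i)
  end.

Definition ixnil {S : Type} {F : S -> Type} x (i : ix [::] x) : F x :=
  match i in ix s z return match s with [::] => F z | _ => unit end with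
  | ix0 _ _ => tt
  | ixS _ _ _ _ => tt
  end.

Definition scons {S : Type} {F : S -> Type} y s (f0 : F y)
    (f : forall x, ix s x -> F x) : forall x, ix (y :: s) x -> F x :=
  fun x i =>
    match i in ix s' x' return
      match s' with
      | [::] => unit
      | y' :: s'' => F y' -> (forall z, ix s'' z -> F z) -> F x'
      end
    with
    | ix0 _ _ => fun f0 _ => f0
    | ixS _ _ _ j => fun _ f => f _ j
    end f0 f.

Fixpoint scat {S : Type} {F : S -> Type} (s1 s2 : seq S) :
    (forall x, ix s1 x -> F x) -> (forall x, ix s2 x -> F x) ->
    forall x, ix (s1 ++ s2) x -> F x :=
  match s1 with
  | [::] => fun _ g => g
  | y :: s1' => fun f g => scons (f y ix0) (scat (fun x i => f x (ixS y i)) g)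
  end.

(* [ty n] has n bound algebra variables in scope.  The domain of an arrow lives
   in [ty 0], so bound algebra variables occur strictly positively only.  An
   algebra is the list, over its constructors, of the lists of argument types,
   the variable of the algebra itself being [tbd ord0]. *)
Inductive ty : nat -> Type :=
| tvar n : nat -> ty n
| tbd n : 'I_n -> ty n
| arr n : ty 0 -> ty n -> ty n
| alg n : seq (seq (ty n.+1)) -> ty n.

Fixpoint tyren n (t : ty n) : forall m, ('I_n -> 'I_m) -> ty m :=
  match t with
  | tvar _ a => fun m _ => tvar m a
  | tbd _ i => fun m r => tbd (r i)
  | arr _ t1 t2 => fun m r => arr t1 (tyren t2 r)
  | alg _ cs => fun m r =>
      alg (map (map (fun t => tyren t
        (fun i => if unlift ord0 i is Some j then lift ord0 (r j)
                  else ord0))) cs)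
  end.

Fixpoint tysub n (t : ty n) : forall m, ('I_n -> ty m) -> ty m :=
  match t with
  | tvar _ a => fun m _ => tvar m a
  | tbd _ i => fun m s => s i
  | arr _ t1 t2 => fun m s => arr t1 (tysub t2 s)
  | alg _ cs => fun m s =>
      alg (map (map (fun t => tysub t
        (fun i => if unlift ord0 i is Some j then tyren (s j) (lift ord0)
                  else tbd ord0))) cs)
  end.

Definition type : Type := ty 0.
Definition ctx : Type := seq type.
Definition arity : Type := seq type.

Definition con_args (cs : seq (seq (ty 1))) (args : seq (ty 1)) : seq type :=
  [seq tysub r (fun _ => alg cs) | r <- args].

Definition con_type (cs : seq (seq (ty 1))) (args : seq (ty 1)) : type :=
  foldr (@arr 0) (alg cs) (con_args cs args).

Definition boole_cons : seq (seq (ty 1)) := [:: [::]; [::]].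
Definition boole : type := alg boole_cons.

(* The second index lists the variables of the pattern from left to right, each
   occurring once: patterns are linear.  (Without linearity, D x x := t and
   D x (Sx) := f would be non-unifiable, and a term u := Su would identify
   t and f.) *)
Inductive pat : type -> ctx -> Type :=
| pvar r : pat r [:: r]
| pcon cs args G : ix cs args -> pats (con_args cs args) G -> pat (alg cs) G
with pats : seq type -> ctx -> Type :=
| patnil : pats [::] [::]
| patcons r rs G1 G2 : pat r G1 -> pats rs G2 -> pats (r :: rs) (G1 ++ G2).

(* Left-hand sides D P_0 ... P_(m-1) : t of a rule for D : r. *)
Inductive lhs : type -> type -> ctx -> Type :=
| lnil t : lhs t t [::]
| lcons r s t G1 G2 : pat r G1 -> lhs s t G2 -> lhs (arr r s) t (G1 ++ G2).

(* First-order instances of patterns, as trees: a constructor is a node labelled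
   by its position in the algebra. *)
Definition assignment (G : ctx) : Type :=
  forall r, ix G r -> GenTree.tree nat.

Fixpoint pat_inst r G (p : pat r G) : assignment G -> GenTree.tree nat :=
  match p with
  | pvar r => fun th => th r ix0
  | pcon _ _ _ j ps => fun th => GenTree.Node (pos j) (pats_inst ps th)
  end
with pats_inst rs G (ps : pats rs G) : assignment G -> seq (GenTree.tree nat) :=
  match ps with
  | patnil => fun _ => [::]
  | patcons _ _ G1 G2 p ps' => fun th =>
      pat_inst p (fun r i => th r (ixl G2 i)) ::
      pats_inst ps' (fun r i => th r (ixr G1 i))
  end.

Fixpoint lhs_inst r t G (l : lhs r t G) :
    assignment G -> seq (GenTree.tree nat) :=
  match l with
  | lnil _ => fun _ => [::]
  | lcons _ _ _ G1 G2 p l' => fun th =>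
      pat_inst p (fun r i => th r (ixl G2 i)) ::
      lhs_inst l' (fun r i => th r (ixr G1 i))
  end.

Definition unifiable r t G G' (l : lhs r t G) (l' : lhs r t G') : Prop :=
  exists th th', lhs_inst l th = lhs_inst l' th'.

(* Left-hand sides of a finite system of (possibly mutually recursive) program
   constants; the constant of index j has [nrules j] rules. [bname] allows
   distinct constants with the same computation rules. *)
Record block : Type := Block {
  bname : nat;
  consts : seq type;
  res : forall r, ix consts r -> type;
  nrules : forall r, ix consts r -> nat;
  rvars : forall r (j : ix consts r), 'I_(nrules j) -> ctx;
  rlhs : forall r (j : ix consts r) (i : 'I_(nrules j)),
           lhs r (res j) (rvars i);
  nonunif : forall r (j : ix consts r) (i i' : 'I_(nrules j)),
           unifiable (rlhs i) (rlhs i') -> i = i' }.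

(* [prog B rhs j] is the constant of index j of the system whose left-hand sides
   are given by B and whose right-hand sides are [rhs]; these may contain the
   constants of the system (as variables, listed first), the variables of the
   patterns and any other constants. *)
Inductive tm : ctx -> type -> Type :=
| var G r : ix G r -> tm G r
| lam G r s : tm (r :: G) s -> tm G (arr r s)
| app G r s : tm G (arr r s) -> tm G r -> tm G s
| con G cs args : ix cs args -> tm G (con_type cs args)
| prog G (B : block)
    (rhs : forall r (j : ix (consts B) r) (i : 'I_(nrules j)),
             tm (consts B ++ rvars i) (res j))
    r (j : ix (consts B) r) : tm G r.

Definition ren (G H : ctx) : Type := forall r, ix G r -> ix H r.
Definition sub (G H : ctx) : Type := forall r, ix G r -> tm H r.

Definition upr G H s (f : ren G H) : ren (s :: G) (s :: H) :=
  scons (F := ix (s :: H)) ix0 (fun r i => ixS s (f r i)).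

Fixpoint tren G r (t : tm G r) : forall H, ren G H -> tm H r :=
  match t with
  | var _ _ i => fun H f => var (f _ i)
  | lam _ _ _ u => fun H f => lam (tren u (upr f))
  | app _ _ _ u v => fun H f => app (tren u f) (tren v f)
  | con _ _ _ i => fun H _ => con H i
  | prog _ B rhs _ j => fun H _ => prog H rhs j
  end.

Definition ups G H s (f : sub G H) : sub (s :: G) (s :: H) :=
  scons (F := tm (s :: H)) (var ix0) (fun r i => tren (f r i) (fun _ => ixS s)).

Fixpoint tsub G r (t : tm G r) : forall H, sub G H -> tm H r :=
  match t with
  | var _ _ i => fun H f => f _ i
  | lam _ _ _ u => fun H f => lam (tsub u (ups f))
  | app _ _ _ u v => fun H f => app (tsub u f) (tsub v f)
  | con _ _ _ i => fun H _ => con H i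
  | prog _ B rhs _ j => fun H _ => prog H rhs j
  end.

Definition vsub G H (f : ren G H) : sub G H := fun r i => var (f r i).
Definition sub1 G r (t : tm G r) : sub (r :: G) G :=
  scons (F := tm G) t (@var G).

Inductive tms (G : ctx) : arity -> Type :=
| tnil : tms G [::]
| tcons r a : tm G r -> tms G a -> tms G (r :: a).
Arguments tnil {G}.

Fixpoint tmssub G a (ts : tms G a) H (f : sub G H) : tms H a :=
  match ts with
  | tnil => tnil
  | tcons _ _ t ts' => tcons (tsub t f) (tmssub ts' f)
  end.

Fixpoint look G a (ts : tms G a) : sub a G :=
  match ts in tms _ a return sub a G with
  | tnil => fun r => ixnil (F := tm G) (x := r)
  | tcons _ _ t ts' => scons (F := tm G) t (look ts')
  end.

Fixpoint varlist a G : ren a G -> tms G a :=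
  match a with
  | [::] => fun _ => tnil
  | r :: a' => fun f =>
      tcons (var (f r ix0)) (varlist (fun s i => f s (ixS r i)))
  end.

Definition idvars (a : arity) : tms a a := varlist (fun _ i => i).

Definition bff G : tm G boole :=
  con G (ix0 : ix boole_cons [::]).
Definition btt G : tm G boole :=
  con G (ixS [::] ix0 : ix boole_cons [::]).

(* The pattern P, resp. D P_0 ... P_(m-1), under a substitution. *)
Fixpoint pat_tm r G (p : pat r G) : forall H, sub G H -> tm H r :=
  match p with
  | pvar r => fun H th => th r ix0
  | pcon cs args G j ps => fun H th =>
      pats_app (con H j : tm H (con_type cs args)) ps th
  end
with pats_app rs G H t (h : tm H (foldr (@arr 0) t rs)) (ps : pats rs G) :
    sub G H -> tm H t :=
  match ps in pats rs G
    return tm H (foldr (@arr 0) t rs) -> sub G H -> tm H t with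
  | patnil => fun h _ => h
  | patcons _ _ G1 G2 p ps' => fun h th =>
      pats_app (app h (pat_tm p (fun r i => th r (ixl G2 i)))) ps'
        (fun r i => th r (ixr G1 i))
  end h.

Fixpoint lhs_app r t G (l : lhs r t G) :
    forall H, tm H r -> sub G H -> tm H t :=
  match l with
  | lnil _ => fun H h _ => h
  | lcons _ _ _ G1 G2 p l' => fun H h th =>
      lhs_app l' (app h (pat_tm p (fun r i => th r (ixl G2 i))))
        (fun r i => th r (ixr G1 i))
  end.

Inductive teq : forall G r, tm G r -> tm G r -> Prop :=
| teq_refl G r (t : tm G r) : teq t t
| teq_sym G r (t u : tm G r) : teq t u -> teq u t
| teq_trans G r (t u v : tm G r) : teq t u -> teq u v -> teq t v
| teq_lam G r s (t u : tm (r :: G) s) : teq t u -> teq (lam t) (lam u)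
| teq_app G r s (t t' : tm G (arr r s)) (u u' : tm G r) :
    teq t t' -> teq u u' -> teq (app t u) (app t' u')
| teq_beta G r s (t : tm (r :: G) s) (u : tm G r) :
    teq (app (lam t) u) (tsub t (sub1 u))
| teq_comp G (B : block) rhs r (j : ix (consts B) r) (i : 'I_(nrules j))
    (th : sub (rvars i) G) :
    teq (lhs_app (rlhs i) (prog G rhs j) th)
        (tsub (rhs r j i) (scat (F := tm G) (@prog G B rhs) th)).

Inductive tmseq G : forall a, tms G a -> tms G a -> Prop :=
| tmseq_nil : tmseq tnil tnil
| tmseq_cons r a (t u : tm G r) (ts us : tms G a) :
    teq t u -> tmseq ts us -> tmseq (tcons t ts) (tcons u us).

(* The first index D lists the arities of the bound predicate variables in
   scope, i.e. those bound by a surrounding mu or nu.  The premise of an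
   implication lives in the empty scope, so bound predicate variables occur
   strictly positively only, also inside the clauses of nested predicates.
   Predicates (and clauses) have no free term variables.
   [pvarn X n a] is the free predicate variable X^(n) of arity a. *)
Inductive predicate : seq arity -> arity -> Type :=
| pvarn D : nat -> nat -> forall a, predicate D a
| pbd D a : ix D a -> predicate D a
| compr D a : formula D a -> predicate D a
| mu D a : clauses D a -> predicate D a
| nu D a : clauses D a -> predicate D a
with formula : seq arity -> ctx -> Type :=
| atom D G a : predicate D a -> tms G a -> formula D G
| imp D G : formula [::] G -> formula D G -> formula D G
| cnj D G : formula D G -> formula D G -> formula D G
| dsj D G : formula D G -> formula D G -> formula D G
| all1 D G r : formula D (r :: G) -> formula D G
| ex1 D G r : formula D (r :: G) -> formula D G
with prems : seq arity -> ctx -> Type :=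
| pnil D G : prems D G
| pcons D G : formula D G -> prems D G -> prems D G
with clauses : seq arity -> arity -> Type :=
| cnil D a : clauses D a
| ccons D a G : prems (a :: D) G -> tms G a -> clauses D a -> clauses D a.

Arguments pvarn D X n a : rename.
Arguments pnil {D G}.
Arguments cnil {D a}.

Infix "⊃" := imp (at level 55, right associativity).

Record clause D a : Type := Clause {
  cvars : ctx;
  cprems : seq (formula (a :: D) cvars);
  cargs : tms cvars a }.

Fixpoint plist D G (ps : prems D G) : seq (formula D G) :=
  match ps with pnil _ _ => [::] | pcons _ _ A ps' => A :: plist ps' end.

Fixpoint clist D a (K : clauses D a) : seq (clause D a) :=
  match K with
  | cnil _ _ => [::]
  | ccons _ _ _ ps ts K' => Clause (plist ps) ts :: clist K'
  end.

Fixpoint fsub D G (A : formula D G) : forall H, sub G H -> formula D H :=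
  match A with
  | atom _ _ _ P ts => fun H f => atom P (tmssub ts f)
  | imp _ _ A B => fun H f => fsub A f ⊃ fsub B f
  | cnj _ _ A B => fun H f => cnj (fsub A f) (fsub B f)
  | dsj _ _ A B => fun H f => dsj (fsub A f) (fsub B f)
  | all1 _ _ _ A => fun H f => all1 (fsub A (ups f))
  | ex1 _ _ _ A => fun H f => ex1 (fsub A (ups f))
  end.

Definition fren D G H (f : ren G H) (A : formula D G) : formula D H :=
  fsub A (vsub f).
Definition wk D G r (A : formula D G) : formula D (r :: G) :=
  fren (fun _ => ixS r) A.

Definition pren (D E : seq arity) : Type := forall a, ix D a -> ix E a.
Definition psub (D E : seq arity) : Type := forall a, ix D a -> predicate E a.

Definition uppr D E a (f : pren D E) : pren (a :: D) (a :: E) :=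
  scons (F := ix (a :: E)) ix0 (fun b i => ixS a (f b i)).

Fixpoint pred_ren D a (P : predicate D a) :
    forall E, pren D E -> predicate E a :=
  match P with
  | pvarn _ X n a => fun E _ => pvarn E X n a
  | pbd _ _ i => fun E f => pbd (f _ i)
  | compr _ _ A => fun E f => compr (form_ren A f)
  | mu _ _ K => fun E f => mu (clauses_ren K f)
  | nu _ _ K => fun E f => nu (clauses_ren K f)
  end
with form_ren D G (A : formula D G) : forall E, pren D E -> formula E G :=
  match A with
  | atom _ _ _ P ts => fun E f => atom (pred_ren P f) ts
  | imp _ _ A B => fun E f => A ⊃ form_ren B f
  | cnj _ _ A B => fun E f => cnj (form_ren A f) (form_ren B f)
  | dsj _ _ A B => fun E f => dsj (form_ren A f) (form_ren B f)
  | all1 _ _ _ A => fun E f => all1 (form_ren A f)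
  | ex1 _ _ _ A => fun E f => ex1 (form_ren A f)
  end
with prems_ren D G (ps : prems D G) : forall E, pren D E -> prems E G :=
  match ps with
  | pnil _ _ => fun E _ => pnil
  | pcons _ _ A ps' => fun E f => pcons (form_ren A f) (prems_ren ps' f)
  end
with clauses_ren D a (K : clauses D a) : forall E, pren D E -> clauses E a :=
  match K with
  | cnil _ _ => fun E _ => cnil
  | ccons _ a _ ps ts K' => fun E f =>
      ccons (prems_ren ps (uppr f)) ts (clauses_ren K' f)
  end.

Definition upps D E a (f : psub D E) : psub (a :: D) (a :: E) :=
  scons (F := predicate (a :: E)) (pbd ix0)
    (fun b i => pred_ren (f b i) (fun _ => ixS a)).

Fixpoint pred_sub D a (P : predicate D a) :
    forall E, psub D E -> predicate E a :=
  match P with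
  | pvarn _ X n a => fun E _ => pvarn E X n a
  | pbd _ _ i => fun E f => f _ i
  | compr _ _ A => fun E f => compr (form_sub A f)
  | mu _ _ K => fun E f => mu (clauses_sub K f)
  | nu _ _ K => fun E f => nu (clauses_sub K f)
  end
with form_sub D G (A : formula D G) : forall E, psub D E -> formula E G :=
  match A with
  | atom _ _ _ P ts => fun E f => atom (pred_sub P f) ts
  | imp _ _ A B => fun E f => A ⊃ form_sub B f
  | cnj _ _ A B => fun E f => cnj (form_sub A f) (form_sub B f)
  | dsj _ _ A B => fun E f => dsj (form_sub A f) (form_sub B f)
  | all1 _ _ _ A => fun E f => all1 (form_sub A f)
  | ex1 _ _ _ A => fun E f => ex1 (form_sub A f)
  end
with prems_sub D G (ps : prems D G) : forall E, psub D E -> prems E G :=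
  match ps with
  | pnil _ _ => fun E _ => pnil
  | pcons _ _ A ps' => fun E f => pcons (form_sub A f) (prems_sub ps' f)
  end
with clauses_sub D a (K : clauses D a) : forall E, psub D E -> clauses E a :=
  match K with
  | cnil _ _ => fun E _ => cnil
  | ccons _ a _ ps ts K' => fun E f =>
      ccons (prems_sub ps (upps f)) ts (clauses_sub K' f)
  end.

Definition pinst D G a (P : predicate D a) (A : formula (a :: D) G) :
    formula D G :=
  form_sub A (scons (F := predicate D) P (@pbd D)).

(* Occurrence of the term variable of index n; terms and formulas are taken as
   written, not up to conversion. *)
Fixpoint occ_tm n G r (t : tm G r) : bool :=
  match t with
  | var _ _ i => pos i == n
  | lam _ _ _ u => occ_tm n.+1 u
  | app _ _ _ u v => occ_tm n u || occ_tm n v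
  | con _ _ _ _ => false
  | prog _ _ _ _ _ => false
  end.

Fixpoint occ_tms n G a (ts : tms G a) : bool :=
  match ts with
  | tnil => false
  | tcons _ _ t ts' => occ_tm n t || occ_tms n ts'
  end.

Fixpoint occ n D G (A : formula D G) : bool :=
  match A with
  | atom _ _ _ _ ts => occ_tms n ts
  | imp _ _ A B => occ n A || occ n B
  | cnj _ _ A B => occ n A || occ n B
  | dsj _ _ A B => occ n A || occ n B
  | all1 _ _ _ A => occ n.+1 A
  | ex1 _ _ _ A => occ n.+1 A
  end.

(* {x | A} binds exactly the free term variables of A. *)
Fixpoint wf_pred D a (P : predicate D a) : bool :=
  match P with
  | pvarn _ _ _ _ => true
  | pbd _ _ _ => true
  | compr _ a A => all (fun i => occ i A) (iota 0 (size a)) && wf A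
  | mu _ _ K => wf_clauses K
  | nu _ _ K => wf_clauses K
  end
with wf D G (A : formula D G) : bool :=
  match A with
  | atom _ _ _ P _ => wf_pred P
  | imp _ _ A B => wf A && wf B
  | cnj _ _ A B => wf A && wf B
  | dsj _ _ A B => wf A && wf B
  | all1 _ _ _ A => wf A
  | ex1 _ _ _ A => wf A
  end
with wf_prems D G (ps : prems D G) : bool :=
  match ps with
  | pnil _ _ => true
  | pcons _ _ A ps' => wf A && wf_prems ps'
  end
with wf_clauses D a (K : clauses D a) : bool :=
  match K with
  | cnil _ _ => true
  | ccons _ _ _ ps _ K' => wf_prems ps && wf_clauses K'
  end.

(* Occurrence of the bound predicate variable of index n. *)
Fixpoint pocc_pred n D a (P : predicate D a) : bool :=
  match P with
  | pvarn _ _ _ _ => false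
  | pbd _ _ i => pos i == n
  | compr _ _ A => pocc n A
  | mu _ _ K => pocc_clauses n K
  | nu _ _ K => pocc_clauses n K
  end
with pocc n D G (A : formula D G) : bool :=
  match A with
  | atom _ _ _ P _ => pocc_pred n P
  | imp _ _ _ B => pocc n B
  | cnj _ _ A B => pocc n A || pocc n B
  | dsj _ _ A B => pocc n A || pocc n B
  | all1 _ _ _ A => pocc n A
  | ex1 _ _ _ A => pocc n A
  end
with pocc_prems n D G (ps : prems D G) : bool :=
  match ps with
  | pnil _ _ => false
  | pcons _ _ A ps' => pocc n A || pocc_prems n ps'
  end
with pocc_clauses n D a (K : clauses D a) : bool :=
  match K with
  | cnil _ _ => false
  | ccons _ _ _ ps _ K' => pocc_prems n.+1 ps || pocc_clauses n K'
  end.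

(* Conversion: identification of terms up to [teq] and of {x | A} t with
   A[x/t], inside arbitrary formulas and predicates. *)
Inductive pred_conv : forall D a, predicate D a -> predicate D a -> Prop :=
| pconv_refl D a (P : predicate D a) : pred_conv P P
| pconv_sym D a (P Q : predicate D a) : pred_conv P Q -> pred_conv Q P
| pconv_trans D a (P Q R : predicate D a) :
    pred_conv P Q -> pred_conv Q R -> pred_conv P R
| pconv_compr D a (A B : formula D a) :
    conv A B -> pred_conv (compr A) (compr B)
| pconv_mu D a (K L : clauses D a) : clauses_conv K L -> pred_conv (mu K) (mu L)
| pconv_nu D a (K L : clauses D a) : clauses_conv K L -> pred_conv (nu K) (nu L)
with conv : forall D G, formula D G -> formula D G -> Prop :=
| conv_refl D G (A : formula D G) : conv A A
| conv_sym D G (A B : formula D G) : conv A B -> conv B A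
| conv_trans D G (A B C : formula D G) : conv A B -> conv B C -> conv A C
| conv_atom D G a (P Q : predicate D a) (ts us : tms G a) :
    pred_conv P Q -> tmseq ts us -> conv (atom P ts) (atom Q us)
| conv_compr D G a (A : formula D a) (ts : tms G a) :
    conv (atom (compr A) ts) (fsub A (look ts))
| conv_imp D G (A A' : formula [::] G) (B B' : formula D G) :
    conv A A' -> conv B B' -> conv (A ⊃ B) (A' ⊃ B')
| conv_conj D G (A A' B B' : formula D G) :
    conv A A' -> conv B B' -> conv (cnj A B) (cnj A' B')
| conv_disj D G (A A' B B' : formula D G) :
    conv A A' -> conv B B' -> conv (dsj A B) (dsj A' B')
| conv_all D G r (A B : formula D (r :: G)) :
    conv A B -> conv (all1 A) (all1 B)
| conv_ex D G r (A B : formula D (r :: G)) :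
    conv A B -> conv (ex1 A) (ex1 B)
with prems_conv : forall D G, prems D G -> prems D G -> Prop :=
| prconv_nil D G : prems_conv (@pnil D G) pnil
| prconv_cons D G (A B : formula D G) (ps qs : prems D G) :
    conv A B -> prems_conv ps qs -> prems_conv (pcons A ps) (pcons B qs)
with clauses_conv : forall D a, clauses D a -> clauses D a -> Prop :=
| clconv_nil D a : clauses_conv (@cnil D a) cnil
| clconv_cons D a G (ps qs : prems (a :: D) G) (ts us : tms G a)
    (K L : clauses D a) :
    prems_conv ps qs -> tmseq ts us -> clauses_conv K L ->
    clauses_conv (ccons ps ts K) (ccons qs us L).

Definition leibniz D r : predicate D [:: r; r] :=
  mu (ccons (G := [:: r]) pnil
        (tcons (var ix0) (tcons (var ix0) tnil)) cnil).

Definition eqf D G r (t u : tm G r) : formula D G :=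
  atom (leibniz D r) (tcons t (tcons u tnil)).

Definition bot D G : formula D G := eqf D (bff G) (btt G).
(* The empty conjunction. *)
Definition top D G : formula D G := eqf D (bff G) (bff G).
Definition neg G (A : formula [::] G) : formula [::] G := A ⊃ bot [::] G.

Fixpoint bigand D G (As : seq (formula D G)) : formula D G :=
  match As with
  | [::] => top D G
  | [:: A] => A
  | A :: As' => cnj A (bigand As')
  end.

Fixpoint bigor D G (As : seq (formula D G)) : formula D G :=
  match As with
  | [::] => bot D G
  | [:: A] => A
  | A :: As' => dsj A (bigor As')
  end.

Definition thd G r a (ts : tms G (r :: a)) : tm G r := look ts ix0.
Definition ttl G r a (ts : tms G (r :: a)) : tms G a :=
  match ts in tms _ b
    return match b with [::] => unit | _ :: a => tms G a end with
  | tnil => tt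
  | tcons _ _ _ ts' => ts'
  end.

Fixpoint eqlist D G a (ts : tms G a) : tms G a -> seq (formula D G) :=
  match ts in tms _ a return tms G a -> seq (formula D G) with
  | tnil => fun _ => [::]
  | tcons _ _ t ts' => fun us => eqf D t (thd us) :: eqlist D ts' (ttl us)
  end.

Definition eqsf D G a (ts us : tms G a) : formula D G :=
  bigand (eqlist D ts us).

Fixpoint alls D X G : formula D (X ++ G) -> formula D G :=
  match X with
  | [::] => id
  | r :: X' => fun A => alls (X := X') (all1 A)
  end.

Fixpoint exs D X G : formula D (X ++ G) -> formula D G :=
  match X with
  | [::] => id
  | r :: X' => fun A => exs (X := X') (ex1 A)
  end.

Fixpoint close D G : formula D G -> formula D [::] :=
  match G with
  | [::] => id
  | r :: G' => fun A => close (all1 A)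
  end.

Definition cap D a (P Q : predicate D a) : predicate D a :=
  compr (cnj (atom P (idvars a)) (atom Q (idvars a))).
Definition cup D a (P Q : predicate D a) : predicate D a :=
  compr (dsj (atom P (idvars a)) (atom Q (idvars a))).

(* forall y, P y -> B(y), in the context G. *)
Definition included (G : ctx) a (P : predicate [::] a) (B : formula [::] a) :
    formula [::] G :=
  alls (X := a) (fren (fun _ => @ixl _ a G _) (atom P (idvars a) ⊃ B)).

Definition subp G a (P Q : predicate [::] a) : formula [::] G :=
  included G P (atom Q (idvars a)).

(* forall x_i, A_i0(P) -> ... -> A_i(n_i-1)(P) -> Q t_i, in the context G. *)
Definition clause_form G a (P Q : predicate [::] a) (c : clause [::] a) :
    formula [::] G :=
  alls (X := cvars c) (fren (fun _ => @ixl _ (cvars c) G _)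
    (foldr (@imp [::] (cvars c)) (atom Q (cargs c))
       [seq pinst P A | A <- cprems c])).

(* The body of Phi(P), with free variables y. *)
Definition Phi a (K : clauses [::] a) (P : predicate [::] a) : formula [::] a :=
  bigor [seq exs (X := cvars c)
           (cnj (eqsf [::] (varlist (fun _ => @ixr _ (cvars c) a _))
                    (tmssub (cargs c) (vsub (fun _ => @ixl _ (cvars c) a _))))
                 (bigand [seq fren (fun _ => @ixl _ (cvars c) a _) (pinst P A)
                         | A <- cprems c]))
        | c <- clist K].

Inductive axiom (G : ctx) : formula [::] G -> Prop :=
| ax_conjI A B : axiom (A ⊃ B ⊃ cnj A B)
| ax_conjE1 A B : axiom (cnj A B ⊃ A)
| ax_conjE2 A B : axiom (cnj A B ⊃ B)
| ax_disjI1 A B : axiom (A ⊃ dsj A B)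
| ax_disjI2 A B : axiom (B ⊃ dsj A B)
| ax_disjE A B C : axiom (dsj A B ⊃ (A ⊃ C) ⊃ (B ⊃ C) ⊃ C)
| ax_exI r (A : formula [::] (r :: G)) : axiom (all1 (A ⊃ wk r (ex1 A)))
| ax_exE r (A : formula [::] (r :: G)) B :
    axiom (ex1 A ⊃ all1 (A ⊃ wk r B) ⊃ B)
| ax_mu a (K : clauses [::] a) c :
    List.In c (clist K) -> axiom (clause_form G (mu K) (mu K) c)
| ax_ind a (K : clauses [::] a) (P : predicate [::] a) :
    axiom (foldr (@imp [::] G) (subp G (mu K) P)
             [seq clause_form G (cap (mu K) P) P c | c <- clist K])
| ax_nu a (K : clauses [::] a) :
    axiom (included G (nu K) (Phi K (nu K)))
| ax_coind a (K : clauses [::] a) (Q : predicate [::] a) :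
    axiom (included G Q (Phi K (cup (nu K) Q)) ⊃ subp G Q (nu K)).

Inductive derives : forall G, seq (formula [::] G) -> formula [::] G -> Prop :=
| d_hyp G (H : seq (formula [::] G)) A : List.In A H -> derives H A
| d_ax G (H : seq (formula [::] G)) A : axiom A -> wf A -> derives H A
| d_impI G (H : seq (formula [::] G)) A B :
    wf A -> derives (A :: H) B -> derives H (A ⊃ B)
| d_impE G (H : seq (formula [::] G)) A B :
    derives H (A ⊃ B) -> derives H A -> derives H B
| d_allI G r (H : seq (formula [::] G)) (A : formula [::] (r :: G)) :
    derives (map (@wk _ _ r) H) A -> derives H (all1 A)
| d_allE G r (H : seq (formula [::] G)) (A : formula [::] (r :: G))
    (t : tm G r) :
    derives H (all1 A) -> derives H (fsub A (sub1 t))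
| d_conv G (H : seq (formula [::] G)) A B :
    derives H A -> conv A B -> wf B -> derives H B.

Notation "⊢ A" := (derives [::] A) (at level 65).

(* There are terms t with I t, or some clause of I has no premise in which X
   occurs.  If I lies in the scope of bound predicate variables, these are
   universally quantified placeholders: I t is derivable for all their
   instances.  The second disjunct is a separate clause because such an I (e.g.
   with the single clause bot -> X) need not have a derivable instance. *)
Definition inhabited D a (K : clauses D a) : Prop :=
  (exists G (ts : tms G a), forall s : psub D [::],
     (forall b (i : ix D b), wf_pred (s b i)) ->
     ⊢ atom (pred_sub (mu K) s) ts)
  \/ (exists2 c, List.In c (clist K) & ~~ has (fun A => pocc 0 A) (cprems c)).

Fixpoint inh_pred D a (P : predicate D a) : Prop :=
  match P with
  | pvarn _ _ _ _ => True
  | pbd _ _ _ => True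
  | compr _ _ A => inh A
  | mu _ _ K => inhabited K /\ inh_clauses K
  | nu _ _ K => inh_clauses K
  end
with inh D G (A : formula D G) : Prop :=
  match A with
  | atom _ _ _ P _ => inh_pred P
  | imp _ _ A B => inh A /\ inh B
  | cnj _ _ A B => inh A /\ inh B
  | dsj _ _ A B => inh A /\ inh B
  | all1 _ _ _ A => inh A
  | ex1 _ _ _ A => inh A
  end
with inh_prems D G (ps : prems D G) : Prop :=
  match ps with
  | pnil _ _ => True
  | pcons _ _ A ps' => inh A /\ inh_prems ps'
  end
with inh_clauses D a (K : clauses D a) : Prop :=
  match K with
  | cnil _ _ => True
  | ccons _ _ _ ps _ K' => inh_prems ps /\ inh_clauses K'
  end.

Definition tcf_formula G (A : formula [::] G) : Prop := wf A /\ inh A.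

(* A bound predicate variable X is left in place: in the strong negation of
   mu_X K and nu_X K, every (strictly positive) X becomes X', which is bound
   again at the same position.  [negE K] lists the conjuncts of E(X')(y). *)
Fixpoint negp D a (P : predicate D a) : predicate D a :=
  match P with
  | pvarn D X n a => pvarn D X n.+1 a
  | pbd _ _ i => pbd i
  | compr _ _ A => compr (negf A)
  | mu _ a K => nu (ccons (pcons (bigand (negE K)) pnil) (idvars a) cnil)
  | nu _ a K => mu (ccons (pcons (bigand (negE K)) pnil) (idvars a) cnil)
  end
with negf D G (A : formula D G) : formula D G :=
  match A with
  | atom _ _ _ P ts => atom (negp P) ts
  | imp _ _ A B =>
      cnj (form_ren A (fun a => ixnil (F := ix _) (x := a))) (negf B)
  | cnj _ _ A B => dsj (negf A) (negf B)
  | dsj _ _ A B => cnj (negf A) (negf B)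
  | all1 _ _ _ A => ex1 (negf A)
  | ex1 _ _ _ A => all1 (negf A)
  end
with negps D G (ps : prems D G) : seq (formula D G) :=
  match ps with
  | pnil _ _ => [::]
  | pcons _ _ A ps' => negf A :: negps ps'
  end
with negE D a (K : clauses D a) : seq (formula (a :: D) a) :=
  match K with
  | cnil _ _ => [::]
  | ccons D a X ps ts K' =>
      alls (X := X)
        (eqsf [::] (varlist (fun _ => @ixr _ X a _))
           (tmssub ts (vsub (fun _ => @ixl _ X a _)))
         ⊃ fren (fun _ => @ixl _ X a _) (bigor (negps ps)))
      :: negE K'
  end.

(* (X, n, a) stands for X^(n) of arity a; bound variables do not count. *)
Fixpoint PP_pred D a (P : predicate D a) : seq (nat * nat * arity) :=
  match P with
  | pvarn _ X n a => [:: (X, n, a)]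
  | pbd _ _ _ => [::]
  | compr _ _ A => PP A
  | mu _ _ K => PP_clauses K
  | nu _ _ K => PP_clauses K
  end
with PP D G (A : formula D G) : seq (nat * nat * arity) :=
  match A with
  | atom _ _ _ P _ => PP_pred P
  | imp _ _ _ B => PP B
  | cnj _ _ A B => PP A ++ PP B
  | dsj _ _ A B => PP A ++ PP B
  | all1 _ _ _ A => PP A
  | ex1 _ _ _ A => PP A
  end
with PP_prems D G (ps : prems D G) : seq (nat * nat * arity) :=
  match ps with
  | pnil _ _ => [::]
  | pcons _ _ A ps' => PP A ++ PP_prems ps'
  end
with PP_clauses D a (K : clauses D a) : seq (nat * nat * arity) :=
  match K with
  | cnil _ _ => [::]
  | ccons _ _ _ ps _ K' => PP_prems ps ++ PP_clauses K'
  end.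

(* C_0 -> ... -> C_(n-1) -> B over the variables x_0, ..., x_(n-1).  As the
   innermost variable x_(n-1) has index 0, [C j] is the premise on x_(n-1-j). *)
Definition imps G (C : 'I_(size G) -> formula [::] G) (B : formula [::] G) :
    formula [::] G :=
  foldl (fun B j => C j ⊃ B) B (enum 'I_(size G)).

Definition tight G (A : formula [::] G) : Prop := ⊢ neg (negf A) ⊃ A.

Definition tight_rel G (C : 'I_(size G) -> formula [::] G)
    (A : formula [::] G) : Prop :=
  ⊢ close (imps C (neg (negf A) ⊃ A)).

(* Main.v *)
Require Import Defs.
From Stdlib Require Import FunctionalExtensionality.
From mathcomp Require Import all_boot.

Set Implicit Arguments.
Unset Strict Implicit.
Unset Printing Implicit Defensive.

(** Over minimal logic, the three claims rest on two facts about a formula [A]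
without free strictly positive predicate variables:

- ex falso: [bot ⊃ A] is derivable ([ex_falso_form]);
- contradiction: [A] and [negf A] together derive [bot]
  ([contradiction_form]).

Under the premises [C], claim (1) is a case distinction on [A] or [negf A]:
in the second case [neg (negf A)] yields [bot], hence [A] by ex falso.
For (2), tightness reduces [A] to refuting [negf A], and by contradiction
[negf A] refutes [A], which is against [neg (neg A)].
Claim (3) is pure logic: tightness of a formula passes to its universal closure
([tight_all1]) and, relative to a premise, to an implication
([tight_premises]), because strong negation turns them into an existential
quantifier and a conjunction.

Both facts are proved by simultaneous induction on predicates and formulas
([ex_falso], [contradiction]).  As the induction enters the clauses of a mu or
nu, its formulas acquire bound predicate variables; the statements therefore
speak of all closed instances of these variables, and assume of the instances
what is to be proved of the formula.

Ex falso starts from the case distinction [cond] on booleans: since [bot] says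
that false and true are Leibniz equal, it identifies any two argument lists of
any predicate ([bot_transport]).  Hence an inductive predicate holds everywhere
as soon as it holds somewhere, and this is what being inhabited provides.
A coinductive predicate holds everywhere by coinduction on a predicate implied
by [bot].

For contradiction, let [I] be a mu and [N] its strong negation, a nu.  Each
step of the induction on [I], showing that [I] refutes [N], unfolds [N] once:
the defining formula of [N], instantiated with the clause of [I] at hand, yields
the strong negation of one of the premises of that clause, and the induction
hypothesis for this premise applies.  For a nu, the roles are exchanged: the
induction is on its strong negation, and the nu is unfolded
([incompatible_clause] treats the common core).

The rest is the metatheory that these arguments use: the algebra of
substitutions of terms and of predicates, the closure of derivations under
substitution of terms ([derives_fsub]), and rules for the connectives, for
inductive and coinductive predicates and for Leibniz equality. *)

(** * Families over typed de Bruijn indices *)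

Lemma ix_fun_ext (S : Type) (F : S -> Type) (s : seq S)
    (f g : forall x, ix s x -> F x) :
  (forall x i, f x i = g x i) -> f = g.
Proof.
move=> fg; apply: functional_extensionality_dep => x.
exact: functional_extensionality_dep.
Qed.

(** The return type of the match recomputes the shape of the sequence, so that
no equality between elements of [S] has to be inverted. *)
Lemma ix_caseS (S : Type) (y : S) (s : seq S)
    (P : forall x, ix (y :: s) x -> Prop) :
  P y ix0 -> (forall x i, P x (ixS y i)) -> forall x i, P x i.
Proof.
move=> P0 PS x i.
refine (match i as i in ix s' x' return
   match s' return ix s' x' -> Prop with
   | [::] => fun _ => True
   | y' :: s'' => fun i => forall P : (forall x, ix (y' :: s'') x -> Prop),
       P y' ix0 -> (forall x i, P x (ixS y' i)) -> P x' i
   end i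
 with ix0 _ _ => _ | ixS _ _ _ j => _ end P P0 PS).
- by [].
- by move=> Q _ QS; apply: QS.
Qed.

Lemma ix_case0 (S : Type) (P : forall x : S, ix [::] x -> Prop) :
  forall x i, P x i.
Proof.
move=> x i.
by refine (match i as i in ix s' x' return
   match s' return ix s' x' -> Prop with
   | [::] => fun i => forall P : (forall x : S, ix [::] x -> Prop), P x' i
   | _ => fun _ => True end i
 with ix0 _ _ => I | ixS _ _ _ _ => I end P).
Qed.

Lemma ix_fun_extS (S : Type) (F : S -> Type) (y : S) (s : seq S)
    (f g : forall x, ix (y :: s) x -> F x) :
  f y ix0 = g y ix0 -> (forall x i, f x (ixS y i) = g x (ixS y i)) -> f = g.
Proof.
move=> e0 eS; apply: ix_fun_ext.
exact: (ix_caseS (P := fun x i => f x i = g x i)).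
Qed.

Lemma ix_fun_ext0 (S : Type) (F : S -> Type)
    (f g : forall x, ix [::] x -> F x) : f = g.
Proof.
apply: ix_fun_ext; exact: (ix_case0 (fun x i => f x i = g x i)).
Qed.

Lemma scat_ixl (S : Type) (F : S -> Type) (s1 s2 : seq S)
    (f : forall x, ix s1 x -> F x) (g : forall x, ix s2 x -> F x) x i :
  scat f g (ixl s2 i) = f x i.
Proof. by elim: i f => [s y|s y z i IH] f //=; rewrite IH. Qed.

Lemma scat_ixr (S : Type) (F : S -> Type) (s1 s2 : seq S)
    (f : forall x, ix s1 x -> F x) (g : forall x, ix s2 x -> F x) x i :
  scat f g (ixr s1 i) = g x i.
Proof. by elim: s1 f => [|y s1 IH] f //=. Qed.

Lemma ix_fun_ext_cat (S : Type) (F : S -> Type) (s1 s2 : seq S)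
    (f g : forall x, ix (s1 ++ s2) x -> F x) :
  (forall x i, f x (ixl s2 i) = g x (ixl s2 i)) ->
  (forall x i, f x (ixr s1 i) = g x (ixr s1 i)) -> f = g.
Proof.
elim: s1 f g => [|y s1 IH] f g el er.
  by apply: ix_fun_ext => x i; apply: er.
apply: ix_fun_extS => [|x i]; first exact: (el y ix0).
have E : (fun x i => f x (ixS y i)) = (fun x i => g x (ixS y i)).
  by apply: IH => [z j|z j]; [apply: (el z (ixS y j))|apply: er].
by have := f_equal (fun h => h x i) E.
Qed.

(** * Substitution in terms *)

Lemma upr_comp G H K r (f : ren G H) (g : ren H K) :
  (fun s (i : ix (r :: G) s) => upr g (upr f i)) = upr (fun _ i => g _ (f _ i)).
Proof. exact: ix_fun_extS. Qed.

Lemma tren_tren G r (t : tm G r) H K (f : ren G H) (g : ren H K) :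
  tren (tren t f) g = tren t (fun _ i => g _ (f _ i)).
Proof.
elim: t H K f g => //=
  [{}G {}r s u IH|{}G {}r s u IHu v IHv] H K f g.
- by rewrite IH upr_comp.
- by rewrite IHu IHv.
Qed.

Lemma tsub_tren G r (t : tm G r) H K (f : ren G H) (g : sub H K) :
  tsub (tren t f) g = tsub t (fun _ i => g _ (f _ i)).
Proof.
elim: t H K f g => //=
  [{}G {}r s u IH|{}G {}r s u IHu v IHv] H K f g.
- by rewrite IH; congr (lam (tsub u _)); apply: ix_fun_extS.
- by rewrite IHu IHv.
Qed.

Lemma tren_tsub G r (t : tm G r) H K (f : sub G H) (g : ren H K) :
  tren (tsub t f) g = tsub t (fun _ i => tren (f _ i) g).
Proof.
elim: t H K f g => //=
  [{}G {}r s u IH|{}G {}r s u IHu v IHv] H K f g.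
- rewrite IH; congr (lam (tsub u _)); apply: ix_fun_extS => // x i /=.
  by rewrite !tren_tren.
- by rewrite IHu IHv.
Qed.

Definition subc G H K (f : sub G H) (g : sub H K) : sub G K :=
  fun _ i => tsub (f _ i) g.

Lemma ups_comp G H K r (f : sub G H) (g : sub H K) :
  subc (ups (s := r) f) (ups g) = ups (subc f g).
Proof.
apply: ix_fun_extS => // x i; rewrite /subc /=.
by rewrite tsub_tren tren_tsub.
Qed.

Lemma tsub_tsub G r (t : tm G r) H K (f : sub G H) (g : sub H K) :
  tsub (tsub t f) g = tsub t (subc f g).
Proof.
elim: t H K f g => //=
  [{}G {}r s u IH|{}G {}r s u IHu v IHv] H K f g.
- by rewrite IH ups_comp.
- by rewrite IHu IHv.
Qed.

Lemma ups_vsub G H r (f : ren G H) : ups (s := r) (vsub f) = vsub (upr f).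
Proof. exact: ix_fun_extS. Qed.

Lemma ups_var G r : ups (s := r) (@var G) = @var (r :: G).
Proof. exact: ix_fun_extS. Qed.

Lemma tsub_var G r (t : tm G r) : tsub t (@var G) = t.
Proof.
elim: t => //= [{}G {}r s u IH|{}G {}r s u IHu v IHv].
- by rewrite ups_var IH.
- by rewrite IHu IHv.
Qed.

Lemma tsub_vsub G r (t : tm G r) H (f : ren G H) : tsub t (vsub f) = tren t f.
Proof.
elim: t H f => //= [{}G {}r s u IH|{}G {}r s u IHu v IHv] H f.
- by rewrite ups_vsub IH.
- by rewrite IHu IHv.
Qed.

Lemma subc_var G H (f : sub G H) : subc f (@var H) = f.
Proof. by apply: ix_fun_ext => x i; rewrite /subc tsub_var. Qed.

Lemma ups_sub1 G H r (f : sub G H) (t : tm H r) :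
  subc (ups f) (sub1 t) = scons (F := tm H) t f.
Proof.
apply: ix_fun_extS => // x i; rewrite /subc /= tsub_tren.
exact: tsub_var.
Qed.

Lemma ups_wk_sub1 G r :
  subc (ups (vsub (fun _ => ixS r))) (sub1 (var ix0)) = @var (r :: G).
Proof. by rewrite ups_sub1; apply: ix_fun_extS. Qed.

Lemma sub1_subc G H r (f : sub G H) (t : tm G r) :
  subc (sub1 t) f = scons (F := tm H) (tsub t f) f.
Proof. exact: ix_fun_extS. Qed.

Lemma vsubS_ups G H r (f : sub G H) :
  subc (vsub (fun _ => ixS r)) (ups f) = subc f (vsub (fun _ => ixS r)).
Proof. by apply: ix_fun_ext => x i; rewrite /subc tsub_vsub. Qed.

Scheme pat_mind := Induction for pat Sort Prop
with pats_mind := Induction for pats Sort Prop.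
Combined Scheme pat_pats_ind from pat_mind, pats_mind.

Lemma pat_tm_tsub :
  (forall r G (p : pat r G) H K (th : sub G H) (g : sub H K),
     tsub (pat_tm p th) g = pat_tm p (subc th g)) /\
  (forall rs G (ps : pats rs G) H K t (h : tm H (foldr (@arr 0) t rs))
      (th : sub G H) (g : sub H K),
     tsub (pats_app h ps th) g = pats_app (tsub h g) ps (subc th g)).
Proof.
apply: pat_pats_ind => //=.
by move=> r rs G1 G2 p IHp ps IHps H K t h th g; rewrite IHps /= IHp.
Qed.

Lemma lhs_app_tsub r t G (l : lhs r t G) H K (h : tm H r) (th : sub G H)
    (g : sub H K) :
  tsub (lhs_app l h th) g = lhs_app l (tsub h g) (subc th g).
Proof.
elim: l H K h th g => //= {}r s {}t G1 G2 p l IH H K h th g.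
by rewrite IH /= (proj1 pat_tm_tsub).
Qed.

Lemma subc_scat s1 s2 H K (f : sub s1 H) (g : sub s2 H) (h : sub H K) :
  subc (scat (F := tm H) f g) h = scat (F := tm K) (subc f h) (subc g h).
Proof.
by apply: ix_fun_ext_cat => x i; rewrite /subc ?scat_ixl ?scat_ixr.
Qed.

(** In the case of a computation rule, the right-hand side mentions no variables
besides the constants of the block and those of the patterns, so substituting
into an instance of the rule gives another instance of it. *)
Lemma teq_tsub G r (t u : tm G r) : teq t u ->
  forall H (f : sub G H), teq (tsub t f) (tsub u f).
Proof.
elim=> {G r t u} /=.
- by move=> *; apply: teq_refl.
- by move=> G r t u _ IH H f; apply/teq_sym/IH.
- by move=> G r t u v _ IH1 _ IH2 H f; apply: teq_trans (IH1 H f) (IH2 H f).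
- by move=> G r s t u _ IH H f; apply/teq_lam/IH.
- by move=> G r s t t' u u' _ IH1 _ IH2 H f; apply: teq_app; auto.
- move=> G r s t u H f; have := teq_beta (tsub t (ups f)) (tsub u f).
  by rewrite !tsub_tsub ups_sub1 sub1_subc.
- move=> G B rhs r j i th H f; rewrite lhs_app_tsub tsub_tsub subc_scat.
  exact: teq_comp.
Qed.

Lemma tmseq_tmssub G a (ts us : tms G a) H (f : sub G H) :
  tmseq ts us -> tmseq (tmssub ts f) (tmssub us f).
Proof.
by elim=> /= *; constructor=> //; apply: teq_tsub.
Qed.

Lemma tmssub_tmssub G a (ts : tms G a) H K (f : sub G H) (g : sub H K) :
  tmssub (tmssub ts f) g = tmssub ts (subc f g).
Proof. by elim: ts => //= r b t ts ->; rewrite tsub_tsub. Qed.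

Lemma tmssub_var G a (ts : tms G a) : tmssub ts (@var G) = ts.
Proof. by elim: ts => //= r b t ts ->; rewrite tsub_var. Qed.

Lemma look_tmssub G a (ts : tms G a) H (f : sub G H) :
  look (tmssub ts f) = subc (look ts) f.
Proof.
elim: ts => [|r b t ts IH] /=; first exact: ix_fun_ext0.
by apply: ix_fun_extS => // x i /=; rewrite IH.
Qed.

Lemma tmssub_varlist a G H (g : ren a G) (f : sub G H) (ts : tms H a) :
  (forall r i, f r (g r i) = look ts i) -> tmssub (varlist g) f = ts.
Proof.
elim: ts G g f => [|r b t ts IH] G g f fg //=.
by rewrite (fg _ ix0) /= (IH _ (fun x i => g x (ixS r i)) f).
Qed.

Lemma tmssub_idvars G a (ts : tms G a) : tmssub (idvars a) (look ts) = ts.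
Proof. exact: tmssub_varlist. Qed.

Lemma look_varlist a G (g : ren a G) : look (varlist g) = vsub g.
Proof.
elim: a g => [|r a IH] g; first exact: ix_fun_ext0.
by apply: ix_fun_extS => //= x i; rewrite IH.
Qed.

Lemma look_idvars_sub a G (f : sub a G) : look (tmssub (idvars a) f) = f.
Proof. by rewrite look_tmssub look_varlist. Qed.

(** Transport of a substitution below the quantifier blocks [alls] and [exs]. *)
Definition upn (X : ctx) G H (f : sub G H) : sub (X ++ G) (X ++ H) :=
  (fix up X : sub (X ++ G) (X ++ H) :=
    if X is r :: X' return sub (X ++ G) (X ++ H) then ups (up X') else f) X.
Arguments upn X {G H} f r i : rename.

(** Describes the iterated [ups] on the two halves of the context, which is how
the variables of [alls] and [exs] are addressed. *)
Lemma upnE X G H (f : sub G H) :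
  upn X f = scat (F := tm (X ++ H)) (vsub (fun _ => @ixl _ X H _))
    (subc f (vsub (fun _ => @ixr _ X H _))).
Proof.
elim: X => [|r X IH] /=; first by rewrite subc_var.
rewrite IH; apply: ix_fun_extS => // x i /=; rewrite -tsub_vsub.
set h := (X in tsub _ X); set u := scat _ _.
have -> : tsub (u x i) h = subc u h i by [].
rewrite subc_scat; congr (scat _ _ i); apply: ix_fun_ext => y j.
by rewrite /subc tsub_tsub; congr tsub.
Qed.

Lemma upn_ixl X G H (f : sub G H) :
  subc (vsub (fun _ => @ixl _ X G _)) (upn X f) = vsub (fun _ => @ixl _ X H _).
Proof.
by rewrite upnE; apply: ix_fun_ext => x i; rewrite /subc /= scat_ixl.
Qed.

Lemma upn_ixr X G H (f : sub G H) :
  subc (vsub (fun _ => @ixr _ X G _)) (upn X f) =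
  subc f (vsub (fun _ => @ixr _ X H _)).
Proof.
by rewrite upnE; apply: ix_fun_ext => x i; rewrite {1}/subc /= scat_ixr.
Qed.

Lemma upn_scat X G H (us : sub X H) (f : sub G H) :
  subc (upn X f) (scat (F := tm H) us (@var H)) = scat (F := tm H) us f.
Proof.
rewrite upnE subc_scat; congr scat; apply: ix_fun_ext => x i; rewrite /subc /=.
  by rewrite scat_ixl.
rewrite tsub_vsub tsub_tren -[RHS]tsub_var; congr tsub.
by apply: ix_fun_ext => y j; rewrite scat_ixr.
Qed.

Lemma ixl_scat X G H (us : sub X H) (f : sub G H) :
  subc (vsub (fun _ => @ixl _ X G _)) (scat (F := tm H) us f) = us.
Proof. by apply: ix_fun_ext => x i; rewrite /subc /= scat_ixl. Qed.

(** * Substitution of terms in formulas and derivations *)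

Lemma fsub_fsub D G (A : formula D G) H K (f : sub G H) (g : sub H K) :
  fsub (fsub A f) g = fsub A (subc f g).
Proof.
elim: A H K f g => /=.
- by move=> *; rewrite tmssub_tmssub.
- by move=> {}D {}G A IHA B IHB H K f g; rewrite IHA IHB.
- by move=> {}D {}G A IHA B IHB H K f g; rewrite IHA IHB.
- by move=> {}D {}G A IHA B IHB H K f g; rewrite IHA IHB.
- by move=> {}D {}G r A IHA H K f g; rewrite IHA ups_comp.
- by move=> {}D {}G r A IHA H K f g; rewrite IHA ups_comp.
Qed.

Lemma fsub_var D G (A : formula D G) : fsub A (@var G) = A.
Proof.
elim: A => //=.
- by move=> *; rewrite tmssub_var.
- by move=> {}D {}G A -> B ->.
- by move=> {}D {}G A -> B ->.
- by move=> {}D {}G A -> B ->.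
- by move=> {}D {}G r A IHA; rewrite ups_var IHA.
- by move=> {}D {}G r A IHA; rewrite ups_var IHA.
Qed.

Lemma fsub_wk D G H r (A : formula D G) (f : sub G H) :
  fsub (wk r A) (ups f) = wk r (fsub A f).
Proof. by rewrite /wk /fren !fsub_fsub vsubS_ups. Qed.

Lemma fsub_alls D X G H (A : formula D (X ++ G)) (f : sub G H) :
  fsub (alls A) f = alls (fsub A (upn X f)).
Proof. by elim: X A => [|r X IH] A //=; rewrite IH. Qed.

Lemma fsub_exs D X G H (A : formula D (X ++ G)) (f : sub G H) :
  fsub (exs A) f = exs (fsub A (upn X f)).
Proof. by elim: X A => [|r X IH] A //=; rewrite IH. Qed.

Lemma fsub_bigand D G H (As : seq (formula D G)) (f : sub G H) :
  fsub (bigand As) f = bigand [seq fsub A f | A <- As].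
Proof. by elim: As => [|A As IH] //; case: As IH => [|B As] //= <-. Qed.

Lemma fsub_bigor D G H (As : seq (formula D G)) (f : sub G H) :
  fsub (bigor As) f = bigor [seq fsub A f | A <- As].
Proof. by elim: As => [|A As IH] //; case: As IH => [|B As] //= <-. Qed.

Lemma fsub_foldr_imp G H (As : seq (formula [::] G)) B (f : sub G H) :
  fsub (foldr (@imp [::] G) B As) f =
  foldr (@imp [::] H) (fsub B f) [seq fsub A f | A <- As].
Proof. by elim: As => //= A As ->. Qed.

Lemma tms_cons G r a (ts : tms G (r :: a)) : ts = tcons (thd ts) (ttl ts).
Proof.
by refine (match ts as ts in tms _ a return
  (match a return tms G a -> Prop with [::] => fun _ => True
   | r :: a => fun ts => ts = tcons (thd ts) (ttl ts) end) ts
  with tnil => I | tcons _ _ _ _ => erefl end).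
Qed.

Lemma fsub_eqsf D G a (ts us : tms G a) H (f : sub G H) :
  fsub (eqsf D ts us) f = eqsf D (tmssub ts f) (tmssub us f).
Proof.
rewrite /eqsf fsub_bigand; congr bigand.
elim: ts us => [|r b t ts IH] us //=.
by rewrite (tms_cons us) /= IH.
Qed.

Lemma conv_fsub D G (A B : formula D G) : conv A B ->
  forall H (f : sub G H), conv (fsub A f) (fsub B f).
Proof.
elim=> {D G A B} /=; try by constructor; eauto.
- by move=> D G A B C _ IH1 _ IH2 H f; apply: conv_trans (IH1 H f) (IH2 H f).
- by move=> D G a P Q ts us PQ tu H f; constructor=> //; apply: tmseq_tmssub.
- move=> D G a A ts H f; rewrite fsub_fsub -look_tmssub; exact: conv_compr.
Qed.

Lemma wf_fsub D G (A : formula D G) H (f : sub G H) : wf (fsub A f) = wf A.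
Proof.
elim: A H f => //= {}D {}G A IHA B IHB H f; by rewrite IHA IHB.
Qed.

(** Clauses and inclusions are closed formulas stated in an arbitrary context;
substitution only changes that context. *)
Lemma fsub_clause_form G H a (P Q : predicate [::] a) c (f : sub G H) :
  fsub (clause_form G P Q c) f = clause_form H P Q c.
Proof. by rewrite /clause_form fsub_alls /fren fsub_fsub upn_ixl. Qed.

Lemma fsub_included G H a (P : predicate [::] a) B (f : sub G H) :
  fsub (included G P B) f = included H P B.
Proof. by rewrite /included fsub_alls /fren fsub_fsub upn_ixl. Qed.

Lemma axiom_fsub G H (A : formula [::] G) (f : sub G H) :
  axiom A -> axiom (fsub A f).
Proof.
case=> {A} /=; try by move=> *; constructor.
- move=> r A; have := ax_exI (fsub A (ups f)).
  by rewrite -[ex1 (fsub A _)]/(fsub (ex1 A) f) -fsub_wk.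
- by move=> r A B; rewrite fsub_wk; apply: ax_exE.
- by move=> a K c cK; rewrite fsub_clause_form; apply: ax_mu.
- move=> a K P; rewrite fsub_foldr_imp /subp fsub_included -map_comp.
  rewrite (eq_map (g := fun c => clause_form H (cap (mu K) P) P c)).
    exact: ax_ind.
  by move=> c; rewrite /= fsub_clause_form.
- by move=> a K; rewrite fsub_included; apply: ax_nu.
- by move=> a K Q; rewrite /subp !fsub_included; apply: ax_coind.
Qed.

(** A derivation in a context [G] is thus available at every instance of [G]; in
particular, closed theorems may be used below quantifiers. *)
Theorem derives_fsub G (Hs : seq (formula [::] G)) A : derives Hs A ->
  forall H (f : sub G H), derives [seq fsub B f | B <- Hs] (fsub A f).
Proof.
elim=> {G Hs A}.
- by move=> G Hs A AH H f; apply/d_hyp/(List.in_map (fun B => fsub B f)).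
- by move=> G Hs A ax wfA H f; apply: d_ax (axiom_fsub f ax) _; rewrite wf_fsub.
- by move=> G Hs A B wfA _ IH H f; apply: d_impI (IH H f); rewrite wf_fsub.
- by move=> G Hs A B _ IH1 _ IH2 H f; apply: d_impE (IH1 H f) (IH2 H f).
- move=> G r Hs A _ IH H f /=; apply: d_allI.
  move: (IH _ (ups f)); rewrite -!map_comp.
  by congr derives; apply: eq_map => B; apply: fsub_wk.
- move=> G r Hs A t _ IH H f; have := d_allE (tsub t f) (IH H f).
  by rewrite !fsub_fsub ups_sub1 sub1_subc.
- move=> G Hs A B _ IH AB wfB H f.
  by apply: d_conv (IH H f) (conv_fsub AB f) _; rewrite wf_fsub.
Qed.

Lemma derives_incl G (Hs Hs' : seq (formula [::] G)) A :
  derives Hs A -> List.incl Hs Hs' -> derives Hs' A.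
Proof.
move=> d; elim: d Hs' => {G Hs A}.
- by move=> G Hs A AH Hs' inc; apply/d_hyp/inc.
- by move=> G Hs A ax wfA Hs' _; apply: d_ax.
- move=> G Hs A B wfA _ IH Hs' inc; apply/d_impI/IH => // C [|/inc].
    by left.
  by right.
- by move=> G Hs A B _ IH1 _ IH2 Hs' inc; apply: d_impE (IH1 _ inc) (IH2 _ inc).
- by move=> G r Hs A _ IH Hs' inc; apply/d_allI/IH/(List.incl_map (@wk _ _ r)).
- by move=> G r Hs A t _ IH Hs' inc; apply/d_allE/IH.
- by move=> G Hs A B _ IH AB wfB Hs' inc; apply: d_conv (IH _ inc) AB wfB.
Qed.

(** * Substitution of predicates *)

Scheme predicate_mind := Induction for predicate Sort Prop
with formula_mind := Induction for formula Sort Prop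
with prems_mind := Induction for prems Sort Prop
with clauses_mind := Induction for clauses Sort Prop.
Combined Scheme syntax_ind
  from predicate_mind, formula_mind, prems_mind, clauses_mind.

Lemma in_mapP (S T : Type) (f : S -> T) (s : seq S) y :
  List.In y (map f s) -> exists2 x, List.In x s & y = f x.
Proof.
elim: s => //= x s IH [<-|/IH [z zs ->]]; first by exists x => //; left.
by exists z => //; right.
Qed.

Lemma in_mapI (S T : Type) (f : S -> T) (s : seq S) x :
  List.In x s -> List.In (f x) (map f s).
Proof. exact: List.in_map. Qed.

Lemma uppr_comp D E F a (f : pren D E) (g : pren E F) :
  (fun b (i : ix (a :: D) b) => uppr g (uppr f i)) =
  uppr (fun _ i => g _ (f _ i)).
Proof. exact: ix_fun_extS. Qed.

Lemma ren_ren :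
  (forall D a (P : predicate D a) E F (f : pren D E) (g : pren E F),
     pred_ren (pred_ren P f) g = pred_ren P (fun _ i => g _ (f _ i))) /\
  (forall D G (A : formula D G) E F (f : pren D E) (g : pren E F),
     form_ren (form_ren A f) g = form_ren A (fun _ i => g _ (f _ i))) /\
  (forall D G (ps : prems D G) E F (f : pren D E) (g : pren E F),
     prems_ren (prems_ren ps f) g = prems_ren ps (fun _ i => g _ (f _ i))) /\
  (forall D a (K : clauses D a) E F (f : pren D E) (g : pren E F),
     clauses_ren (clauses_ren K f) g = clauses_ren K (fun _ i => g _ (f _ i))).
Proof.
apply: syntax_ind => //=; try by [move=> *; f_equal; auto].
by move=> D a G ps IHps ts K IHK E F f g; rewrite IHps IHK uppr_comp.
Qed.

Definition psubr D E F (f : pren D E) (s : psub E F) : psub D F :=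
  fun _ i => s _ (f _ i).

Lemma upps_uppr D E F a (f : pren D E) (s : psub E F) :
  psubr (uppr (a := a) f) (upps s) = upps (psubr f s).
Proof. exact: ix_fun_extS. Qed.

Lemma sub_ren :
  (forall D a (P : predicate D a) E F (f : pren D E) (s : psub E F),
     pred_sub (pred_ren P f) s = pred_sub P (psubr f s)) /\
  (forall D G (A : formula D G) E F (f : pren D E) (s : psub E F),
     form_sub (form_ren A f) s = form_sub A (psubr f s)) /\
  (forall D G (ps : prems D G) E F (f : pren D E) (s : psub E F),
     prems_sub (prems_ren ps f) s = prems_sub ps (psubr f s)) /\
  (forall D a (K : clauses D a) E F (f : pren D E) (s : psub E F),
     clauses_sub (clauses_ren K f) s = clauses_sub K (psubr f s)).
Proof.
apply: syntax_ind => //=; try by [move=> *; f_equal; auto].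
by move=> D a G ps IHps ts K IHK E F f g; rewrite IHps IHK upps_uppr.
Qed.

Lemma upps_ren D E F a (s : psub D E) (f : pren E F) :
  (fun b (i : ix (a :: D) b) => pred_ren (upps s i) (uppr f)) =
  upps (fun _ i => pred_ren (s _ i) f).
Proof. by apply: ix_fun_extS => // x i /=; rewrite !(proj1 ren_ren). Qed.

Lemma ren_sub :
  (forall D a (P : predicate D a) E F (s : psub D E) (f : pren E F),
     pred_ren (pred_sub P s) f = pred_sub P (fun _ i => pred_ren (s _ i) f)) /\
  (forall D G (A : formula D G) E F (s : psub D E) (f : pren E F),
     form_ren (form_sub A s) f = form_sub A (fun _ i => pred_ren (s _ i) f)) /\
  (forall D G (ps : prems D G) E F (s : psub D E) (f : pren E F),
     prems_ren (prems_sub ps s) f =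
     prems_sub ps (fun _ i => pred_ren (s _ i) f)) /\
  (forall D a (K : clauses D a) E F (s : psub D E) (f : pren E F),
     clauses_ren (clauses_sub K s) f =
     clauses_sub K (fun _ i => pred_ren (s _ i) f)).
Proof.
apply: syntax_ind => //=; try by [move=> *; f_equal; auto].
by move=> D a G ps IHps ts K IHK E F f g; rewrite IHps IHK upps_ren.
Qed.

Definition psubc D E F (s : psub D E) (t : psub E F) : psub D F :=
  fun _ i => pred_sub (s _ i) t.

Lemma upps_comp D E F a (s : psub D E) (t : psub E F) :
  psubc (upps (a := a) s) (upps t) = upps (psubc s t).
Proof.
apply: ix_fun_extS => // x i; rewrite /psubc /=.
by rewrite (proj1 sub_ren) (proj1 ren_sub).
Qed.

Lemma sub_sub :
  (forall D a (P : predicate D a) E F (s : psub D E) (t : psub E F),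
     pred_sub (pred_sub P s) t = pred_sub P (psubc s t)) /\
  (forall D G (A : formula D G) E F (s : psub D E) (t : psub E F),
     form_sub (form_sub A s) t = form_sub A (psubc s t)) /\
  (forall D G (ps : prems D G) E F (s : psub D E) (t : psub E F),
     prems_sub (prems_sub ps s) t = prems_sub ps (psubc s t)) /\
  (forall D a (K : clauses D a) E F (s : psub D E) (t : psub E F),
     clauses_sub (clauses_sub K s) t = clauses_sub K (psubc s t)).
Proof.
apply: syntax_ind => //=; try by [move=> *; f_equal; auto].
by move=> D a G ps IHps ts K IHK E F f g; rewrite IHps IHK upps_comp.
Qed.

Lemma upps_pbd D a : upps (a := a) (@pbd D) = @pbd (a :: D).
Proof. exact: ix_fun_extS. Qed.

Lemma sub_id :
  (forall D a (P : predicate D a), pred_sub P (@pbd D) = P) /\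
  (forall D G (A : formula D G), form_sub A (@pbd D) = A) /\
  (forall D G (ps : prems D G), prems_sub ps (@pbd D) = ps) /\
  (forall D a (K : clauses D a), clauses_sub K (@pbd D) = K).
Proof.
apply: syntax_ind => //=; try by [move=> *; f_equal; auto].
by move=> D a G ps IHps ts K IHK; rewrite upps_pbd IHps IHK.
Qed.

Lemma form_sub0 G (A : formula [::] G) (s : psub [::] [::]) : form_sub A s = A.
Proof.
rewrite -[RHS](proj1 (proj2 sub_id)); congr form_sub; exact: ix_fun_ext0.
Qed.

Lemma form_ren0_sub E G (A : formula [::] G) (f : pren [::] E)
    (s : psub E [::]) :
  form_sub (form_ren A f) s = A.
Proof. by rewrite (proj1 (proj2 sub_ren)) form_sub0. Qed.

(** Instantiating the bound variable of mu or nu after substituting for the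
outer ones amounts to a single substitution. *)
Lemma upps_scons D a (s : psub D [::]) (P : predicate [::] a) :
  psubc (upps s) (scons (F := predicate [::]) P (@pbd [::])) =
  scons (F := predicate [::]) P s.
Proof.
apply: ix_fun_extS => // x i; rewrite /psubc /= (proj1 sub_ren).
rewrite -[RHS](proj1 sub_id); congr pred_sub; exact: ix_fun_ext0.
Qed.

Lemma pinst_upps D a G (A : formula (a :: D) G) (s : psub D [::]) P :
  pinst P (form_sub A (upps s)) = form_sub A (scons (F := predicate [::]) P s).
Proof. by rewrite /pinst (proj1 (proj2 sub_sub)) upps_scons. Qed.

Lemma form_sub_fsub D G (A : formula D G) H (f : sub G H) E (s : psub D E) :
  form_sub (fsub A f) s = fsub (form_sub A s) f.
Proof. elim: A H f E s => //= *; f_equal; auto. Qed.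

Lemma form_sub_alls D X G (A : formula D (X ++ G)) E (s : psub D E) :
  form_sub (alls A) s = alls (form_sub A s).
Proof. by elim: X A => [|r X IH] A //=; rewrite IH. Qed.

Lemma form_sub_bigand D G (As : seq (formula D G)) E (s : psub D E) :
  form_sub (bigand As) s = bigand [seq form_sub A s | A <- As].
Proof. by elim: As => [|A As IH] //; case: As IH => [|B As] //= <-. Qed.

Lemma form_sub_bigor D G (As : seq (formula D G)) E (s : psub D E) :
  form_sub (bigor As) s = bigor [seq form_sub A s | A <- As].
Proof. by elim: As => [|A As IH] //; case: As IH => [|B As] //= <-. Qed.

(** The argument [s] already acts below the binder of the clause, as [upps] of a
substitution does in [clauses_sub]. *)
Definition clause_sub D E a (c : clause D a) (s : psub (a :: D) (a :: E)) :
    clause E a :=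
  Clause [seq form_sub A s | A <- cprems c] (cargs c).

Lemma plist_sub D G (ps : prems D G) E (s : psub D E) :
  plist (prems_sub ps s) = [seq form_sub A s | A <- plist ps].
Proof. by elim: ps E s => //= {}D {}G A ps IH E s; rewrite IH. Qed.

Lemma clist_sub D a (K : clauses D a) E (s : psub D E) :
  clist (clauses_sub K s) = [seq clause_sub c (upps s) | c <- clist K].
Proof.
elim: K E s => //= {}D {}a G ps ts K IH E s.
by rewrite IH plist_sub.
Qed.

(** * Well-formedness *)

Lemma occ_form_sub D G (A : formula D G) E (s : psub D E) n :
  occ n (form_sub A s) = occ n A.
Proof.
elim: A n E s => //=.
- by move=> {}D {}G A IHA B IHB n E s; rewrite IHB.
- by move=> {}D {}G A IHA B IHB n E s; rewrite IHA IHB.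
- by move=> {}D {}G A IHA B IHB n E s; rewrite IHA IHB.
Qed.

Lemma occ_form_ren D G (A : formula D G) E (f : pren D E) n :
  occ n (form_ren A f) = occ n A.
Proof.
elim: A n E f => //=.
- by move=> {}D {}G A IHA B IHB n E s; rewrite IHB.
- by move=> {}D {}G A IHA B IHB n E s; rewrite IHA IHB.
- by move=> {}D {}G A IHA B IHB n E s; rewrite IHA IHB.
Qed.

Lemma wf_ren :
  (forall D a (P : predicate D a) E (f : pren D E),
     wf_pred (pred_ren P f) = wf_pred P) /\
  (forall D G (A : formula D G) E (f : pren D E),
     wf (form_ren A f) = wf A) /\
  (forall D G (ps : prems D G) E (f : pren D E),
     wf_prems (prems_ren ps f) = wf_prems ps) /\
  (forall D a (K : clauses D a) E (f : pren D E),
     wf_clauses (clauses_ren K f) = wf_clauses K).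
Proof.
apply: syntax_ind => //=; try by [move=> *; f_equal; auto].
move=> D a A IH E f; rewrite IH; congr andb; apply: eq_all => i.
exact: occ_form_ren.
Qed.

Definition wf_psub D E (s : psub D E) : Prop := forall b i, wf_pred (s b i).

Lemma wf_upps D E a (s : psub D E) : wf_psub s -> wf_psub (upps (a := a) s).
Proof.
move=> ws; apply: (ix_caseS (P := fun b i => wf_pred (upps s i))) => //= b i.
by rewrite (proj1 wf_ren).
Qed.

Lemma wf_scons D E a (P : predicate E a) (s : psub D E) :
  wf_pred P -> wf_psub s -> wf_psub (scons (F := predicate E) P s).
Proof.
by move=> wP ws; apply: (ix_caseS (P := fun b i => wf_pred (scons P s i))).
Qed.

(** Term variables occur neither in the substituted predicates nor in the bound
predicate variables that they replace, so comprehensions keep binding exactly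
their free variables. *)
Lemma wf_sub :
  (forall D a (P : predicate D a) E (s : psub D E),
     wf_pred P -> wf_psub s -> wf_pred (pred_sub P s)) /\
  (forall D G (A : formula D G) E (s : psub D E),
     wf A -> wf_psub s -> wf (form_sub A s)) /\
  (forall D G (ps : prems D G) E (s : psub D E),
     wf_prems ps -> wf_psub s -> wf_prems (prems_sub ps s)) /\
  (forall D a (K : clauses D a) E (s : psub D E),
     wf_clauses K -> wf_psub s -> wf_clauses (clauses_sub K s)).
Proof.
apply: syntax_ind => //=;
  try by [move=> *; repeat match goal with
    H : is_true (_ && _) |- _ => case/andP: H => ? ? end;
    repeat (apply/andP; split); auto].
- move=> D a A IH E s /andP [/allP oA wA] ws; rewrite IH // andbT.
  by apply/allP => i /oA; rewrite occ_form_sub.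
- move=> D a G ps IHps ts K IHK E s /andP [wps wK] ws.
  by rewrite IHps ?IHK //; apply: wf_upps.
Qed.

Lemma wf_pred_sub D a (P : predicate D a) E (s : psub D E) :
  wf_pred P -> wf_psub s -> wf_pred (pred_sub P s).
Proof. exact: (proj1 wf_sub). Qed.

Lemma wf_form_sub D G (A : formula D G) E (s : psub D E) :
  wf A -> wf_psub s -> wf (form_sub A s).
Proof. exact: (proj1 (proj2 wf_sub)). Qed.

Lemma wf_prems_plist D G (ps : prems D G) A :
  wf_prems ps -> List.In A (plist ps) -> wf A.
Proof.
elim: ps A => //= {}D {}G B ps IH A /andP [wB wps] [<- //|]; exact: IH.
Qed.

Definition wf_clause D a (c : clause D a) : Prop :=
  forall A, List.In A (cprems c) -> wf A.

Lemma wf_clauses_clist D a (K : clauses D a) c :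
  wf_clauses K -> List.In c (clist K) -> wf_clause c.
Proof.
elim: K c => //= {}D {}a G ps ts K IH c /andP [wps wK] [<-|]; last exact: IH.
by move=> A /=; apply: wf_prems_plist.
Qed.

Lemma wf_fren D G H (A : formula D G) (f : ren G H) : wf (fren f A) = wf A.
Proof. exact: wf_fsub. Qed.

Lemma wf_wk D G r (A : formula D G) : wf (wk r A) = wf A.
Proof. exact: wf_fsub. Qed.

Lemma wf_alls D X G (A : formula D (X ++ G)) : wf (alls A) = wf A.
Proof. by elim: X A => //= r X IH A; rewrite IH. Qed.

Lemma wf_exs D X G (A : formula D (X ++ G)) : wf (exs A) = wf A.
Proof. by elim: X A => //= r X IH A; rewrite IH. Qed.

Definition wfs D G (As : seq (formula D G)) : Prop :=
  forall A, List.In A As -> wf A.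

Lemma wfs_cons D G (A : formula D G) As : wfs (A :: As) <-> wf A /\ wfs As.
Proof.
split=> [wAs|[wA wAs] B [<- //|]]; last exact: wAs.
by split=> [|B BAs]; apply: wAs; [left|right].
Qed.

Lemma wfs_map (T : Type) D G (h : T -> formula D G) (l : seq T) :
  (forall x, List.In x l -> wf (h x)) -> wfs (map h l).
Proof. by move=> wh A Ain; have [x xl ->] := in_mapP Ain; apply: wh. Qed.

Lemma wf_bigand D G (As : seq (formula D G)) : wfs As -> wf (bigand As).
Proof.
elim: As => [|A As IH] // /wfs_cons [wA /IH wAs].
by case: As wAs {IH} => [|B As] //= ->; rewrite wA.
Qed.

Lemma wf_bigor D G (As : seq (formula D G)) : wfs As -> wf (bigor As).
Proof.
elim: As => [|A As IH] // /wfs_cons [wA /IH wAs].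
by case: As wAs {IH} => [|B As] //= ->; rewrite wA.
Qed.

Lemma wf_foldr_imp G (As : seq (formula [::] G)) B :
  wfs As -> wf B -> wf (foldr (@imp [::] G) B As).
Proof.
by move=> wAs wB; elim: As wAs => //= A As IH /wfs_cons [-> /IH ->].
Qed.

Lemma wf_eqsf D G a (ts us : tms G a) : wf (eqsf D ts us).
Proof.
apply: wf_bigand; elim: ts us => [|r b t ts IH] us //= A [<- //|].
exact: IH.
Qed.

Lemma wf_pinst D G a (P : predicate D a) (A : formula (a :: D) G) :
  wf_pred P -> wf A -> wf (pinst P A).
Proof. by move=> wP wA; apply: wf_form_sub => //; apply: wf_scons. Qed.

(** The conjunct contributed by a clause to the formula E(X')(y) that defines
the strong negations of mu and nu. *)
Definition neg_clause D a (c : clause D a) : formula (a :: D) a :=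
  alls (X := cvars c)
    (eqsf [::] (varlist (fun _ => @ixr _ (cvars c) a _))
       (tmssub (cargs c) (vsub (fun _ => @ixl _ (cvars c) a _)))
     ⊃ fren (fun _ => @ixl _ (cvars c) a _)
         (bigor [seq negf A | A <- cprems c])).

Lemma negps_plist D G (ps : prems D G) :
  negps ps = [seq negf A | A <- plist ps].
Proof. by elim: ps => //= {}D {}G A ps ->. Qed.

Lemma negE_clist D a (K : clauses D a) :
  negE K = [seq neg_clause c | c <- clist K].
Proof. by elim: K => //= {}D {}a X ps ts K ->; rewrite negps_plist. Qed.

Lemma occ_negf D G (A : formula D G) n : occ n (negf A) = occ n A.
Proof.
elim: A n => //=.
- by move=> {}D {}G A IHA B IHB n; rewrite occ_form_ren IHB.
- by move=> {}D {}G A IHA B IHB n; rewrite IHA IHB.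
- by move=> {}D {}G A IHA B IHB n; rewrite IHA IHB.
Qed.

Lemma wf_neg_clause D a (c : clause D a) :
  (forall A, List.In A (cprems c) -> wf (negf A)) -> wf (neg_clause c).
Proof.
move=> wc; rewrite /neg_clause wf_alls /= wf_eqsf wf_fren.
by apply/wf_bigor/wfs_map.
Qed.

Lemma wf_neg :
  (forall D a (P : predicate D a), wf_pred P -> wf_pred (negp P)) /\
  (forall D G (A : formula D G), wf A -> wf (negf A)) /\
  (forall D G (ps : prems D G), wf_prems ps ->
     forall A, List.In A (plist ps) -> wf (negf A)) /\
  (forall D a (K : clauses D a), wf_clauses K ->
     forall c, List.In c (clist K) ->
       forall A, List.In A (cprems c) -> wf (negf A)).
Proof.
apply: syntax_ind => //=.
- move=> D a A IH /andP [/allP oA wA]; rewrite IH // andbT.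
  by apply/allP => i /oA; rewrite occ_negf.
- move=> D a K IH wK; rewrite !andbT negE_clist.
  apply/wf_bigand/wfs_map => c cK.
  by apply/wf_neg_clause => A; apply: IH.
- move=> D a K IH wK; rewrite !andbT negE_clist.
  apply/wf_bigand/wfs_map => c cK.
  by apply/wf_neg_clause => A; apply: IH.
- by move=> D G A _ B IH /andP [wA /IH ->]; rewrite (proj1 (proj2 wf_ren)) wA.
- by move=> D G A IHA B IHB /andP [/IHA -> /IHB ->].
- by move=> D G A IHA B IHB /andP [/IHA -> /IHB ->].
- by move=> D G A IHA ps IHps /andP [wA wps] B [<-|]; [apply: IHA|apply: IHps].
- move=> D a G ps IHps ts K IHK /andP [wps wK] c [<-|]; first exact: IHps.
  exact: IHK.
Qed.

Lemma wf_negf D G (A : formula D G) : wf A -> wf (negf A).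
Proof. exact: (proj1 (proj2 wf_neg)). Qed.

Lemma wf_negf_clist D a (K : clauses D a) c :
  wf_clauses K -> List.In c (clist K) ->
  forall A, List.In A (cprems c) -> wf (negf A).
Proof. by move=> wK; apply: (proj2 (proj2 (proj2 wf_neg)) _ _ _ wK). Qed.

(** * Derived rules for the connectives *)

Lemma incl_nil (T : Type) (l : seq T) : List.incl [::] l.
Proof. by []. Qed.

Lemma incl_cons1 (T : Type) (x : T) (l l' : seq T) :
  List.incl l l' -> List.incl (x :: l) (x :: l').
Proof. by move=> ll y [->|/ll]; [left|right]. Qed.

Lemma derives_weak G (H : seq (formula [::] G)) A : ⊢ A -> derives H A.
Proof. by move=> d; apply: derives_incl d (@incl_nil _ H). Qed.

Lemma derives_cons G (H : seq (formula [::] G)) A B :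
  derives H B -> derives (A :: H) B.
Proof. by move=> d; apply: derives_incl d _ => C; right. Qed.

Lemma derives_hyp0 G (H : seq (formula [::] G)) A : derives (A :: H) A.
Proof. by apply: d_hyp; left. Qed.

Lemma derives_hyp1 G (H : seq (formula [::] G)) A B : derives (B :: A :: H) A.
Proof. by apply: d_hyp; right; left. Qed.

Lemma derives_cut G (H : seq (formula [::] G)) A B :
  wf A -> derives H A -> derives (A :: H) B -> derives H B.
Proof. by move=> wA dA dB; apply: d_impE dA; apply: d_impI. Qed.

(** Most uses of [derives_fsub] are of this form: a theorem at an instance. *)
Lemma derives_inst G H (Hs : seq (formula [::] H)) A (f : sub G H) :
  ⊢ A -> derives Hs (fsub A f).
Proof. by move=> d; apply: derives_weak; have := derives_fsub d f. Qed.

Lemma cnjI G (H : seq (formula [::] G)) A B :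
  wf A -> wf B -> derives H A -> derives H B -> derives H (cnj A B).
Proof.
move=> wA wB dA dB; apply: d_impE dB; apply: d_impE dA.
by apply/d_ax; [apply: ax_conjI|rewrite /= wA wB].
Qed.

Lemma cnjE1 G (H : seq (formula [::] G)) A B :
  wf A -> wf B -> derives H (cnj A B) -> derives H A.
Proof.
by move=> wA wB; apply: d_impE; apply/d_ax; [apply: ax_conjE1|rewrite /= wA wB].
Qed.

Lemma cnjE2 G (H : seq (formula [::] G)) A B :
  wf A -> wf B -> derives H (cnj A B) -> derives H B.
Proof.
by move=> wA wB; apply: d_impE; apply/d_ax; [apply: ax_conjE2|rewrite /= wA wB].
Qed.

Lemma dsjI1 G (H : seq (formula [::] G)) A B :
  wf A -> wf B -> derives H A -> derives H (dsj A B).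
Proof.
by move=> wA wB; apply: d_impE; apply/d_ax; [apply: ax_disjI1|rewrite /= wA wB].
Qed.

Lemma dsjI2 G (H : seq (formula [::] G)) A B :
  wf A -> wf B -> derives H B -> derives H (dsj A B).
Proof.
by move=> wA wB; apply: d_impE; apply/d_ax; [apply: ax_disjI2|rewrite /= wA wB].
Qed.

Lemma dsjE G (H : seq (formula [::] G)) A B C :
  wf A -> wf B -> wf C -> derives H (dsj A B) ->
  derives (A :: H) C -> derives (B :: H) C -> derives H C.
Proof.
move=> wA wB wC dAB dA dB.
apply: d_impE (d_impI wB dB); apply: d_impE (d_impI wA dA).
apply: d_impE dAB; apply/d_ax; first exact: ax_disjE.
by rewrite /= wA wB wC.
Qed.

Lemma fsub_wk1 D G r (A : formula D G) (t : tm G r) :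
  fsub (wk r A) (sub1 t) = A.
Proof.
rewrite /wk /fren fsub_fsub -[RHS]fsub_var; congr fsub; exact: ix_fun_ext.
Qed.

Lemma ex1I G (H : seq (formula [::] G)) r (A : formula [::] (r :: G)) t :
  wf A -> derives H (fsub A (sub1 t)) -> derives H (ex1 A).
Proof.
move=> wA; apply: d_impE; rewrite -(fsub_wk1 (ex1 A) t).
apply: (@d_allE G r H (A ⊃ wk r (ex1 A))); apply: d_ax; first exact: ax_exI.
by rewrite /= wA wf_fsub.
Qed.

Lemma ex1E G (H : seq (formula [::] G)) r (A : formula [::] (r :: G)) B :
  wf A -> wf B ->
  derives H (ex1 A) -> derives (A :: map (@wk _ _ r) H) (wk r B) -> derives H B.
Proof.
move=> wA wB dA dB; have wwB : wf (wk r B) by rewrite wf_wk.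
apply: d_impE (d_allI (d_impI wA dB)); apply: d_impE dA.
by apply: d_ax; [apply: ax_exE|rewrite /= wA wwB wB].
Qed.

Lemma foldr_impE G (H : seq (formula [::] G)) As B :
  derives H (foldr (@imp [::] G) B As) ->
  (forall A, List.In A As -> derives H A) -> derives H B.
Proof.
elim: As => //= A As IH dAs dA; apply: IH => [|C CAs]; last by apply: dA; right.
by apply: d_impE dAs _; apply: dA; left.
Qed.

Lemma foldr_impI G (H : seq (formula [::] G)) As B : wfs As ->
  derives (As ++ H) B -> derives H (foldr (@imp [::] G) B As).
Proof.
elim: As H => //= A As IH H /wfs_cons [wA wAs] d.
apply: d_impI wA _; apply: IH wAs _; apply: derives_incl d _ => C.
rewrite /= !List.in_app_iff /=; tauto.
Qed.

Lemma fren_id D G (A : formula D G) : fren (fun _ i => i) A = A.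
Proof. exact: fsub_var. Qed.

Lemma wk_fren_ixr D X G r (A : formula D G) :
  wk r (fren (fun _ => @ixr _ X G _) A) = fren (fun _ => @ixr _ (r :: X) G _) A.
Proof. by rewrite /wk /fren fsub_fsub. Qed.

Lemma map_wk_ixr X G r (H : seq (formula [::] G)) :
  map (@wk _ _ r) (map (fren (fun _ => @ixr _ X G _)) H) =
  map (fren (fun _ => @ixr _ (r :: X) G _)) H.
Proof. by rewrite -map_comp; apply: eq_map => A; apply: wk_fren_ixr. Qed.

Lemma map_fren_id G (H : seq (formula [::] G)) :
  map (fren (fun _ i => i)) H = H.
Proof. by rewrite (eq_map (@fren_id _ _)) map_id. Qed.

(** A block of quantifiers is opened at once, its variables being the left half
of the extended context. *)
Lemma allsI X G (H : seq (formula [::] G)) (A : formula [::] (X ++ G)) :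
  derives (map (fren (fun _ => @ixr _ X G _)) H) A -> derives H (alls A).
Proof.
elim: X A => [|r X IH] A /=; first by rewrite map_fren_id.
by move=> d; apply/IH/d_allI; rewrite map_wk_ixr.
Qed.

(** Lets the block rules below go by induction on the block, which opens one
quantifier at a time. *)
Lemma scat_cons X G r (us : sub (r :: X) G) :
  scat (F := tm G) us (@var G) =
  subc (ups (scat (F := tm G) (fun _ i => us _ (ixS r i)) (@var G)))
    (sub1 (us r ix0)).
Proof. by rewrite ups_sub1. Qed.

Lemma allsE X G (H : seq (formula [::] G)) (A : formula [::] (X ++ G))
    (us : sub X G) :
  derives H (alls A) -> derives H (fsub A (scat (F := tm G) us (@var G))).
Proof.
elim: X A us => [|r X IH] A us /=; first by rewrite fsub_var.
move=> /(IH _ (fun _ i => us _ (ixS r i))) /(d_allE (us r ix0)).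
by rewrite fsub_fsub -scat_cons.
Qed.

Lemma exsI X G (H : seq (formula [::] G)) (A : formula [::] (X ++ G))
    (us : sub X G) : wf A ->
  derives H (fsub A (scat (F := tm G) us (@var G))) -> derives H (exs A).
Proof.
elim: X A us => [|r X IH] A us wA /=; first by rewrite fsub_var.
move=> d; apply: (IH _ (fun _ i => us _ (ixS r i))) => //=.
apply: (ex1I (t := us r ix0)); first by rewrite wf_fsub.
by rewrite fsub_fsub -scat_cons.
Qed.

Lemma exsE X G (H : seq (formula [::] G)) (A : formula [::] (X ++ G)) B :
  wf A -> wf B -> derives H (exs A) ->
  derives (A :: map (fren (fun _ => @ixr _ X G _)) H)
    (fren (fun _ => @ixr _ X G _) B) ->
  derives H B.
Proof.
elim: X A => [|r X IH] A wA wB /=.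
  move=> dA; rewrite map_fren_id fren_id; exact: derives_cut.
move=> dA d; apply: (IH (ex1 A)) => //.
apply: (ex1E (A := A) (r := r)); rewrite ?wf_fren //; first exact: derives_hyp0.
rewrite wk_fren_ixr /= map_wk_ixr; apply: derives_incl d _.
by apply: incl_cons1 => C; right.
Qed.

Lemma allsI_closed X G (H : seq (formula [::] G)) (B : formula [::] X) :
  ⊢ B -> derives H (alls (X := X) (fren (fun _ => @ixl _ X G _) B)).
Proof. by move=> d; apply/allsI/derives_inst. Qed.

Lemma allsE_closed X G (H : seq (formula [::] G)) (B : formula [::] X)
    (us : sub X G) :
  derives H (alls (X := X) (fren (fun _ => @ixl _ X G _) B)) ->
  derives H (fsub B us).
Proof. by move/(allsE us); rewrite /fren fsub_fsub ixl_scat. Qed.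

(** * Rules for inductive and coinductive predicates *)

Lemma comprE G (H : seq (formula [::] G)) a (A : formula [::] a) ts :
  wf A -> derives H (atom (compr A) ts) -> derives H (fsub A (look ts)).
Proof. by move=> wA d; apply: d_conv d (conv_compr _ _) _; rewrite wf_fsub. Qed.

Lemma comprI G (H : seq (formula [::] G)) a (A : formula [::] a) ts :
  wf_pred (compr A) -> derives H (fsub A (look ts)) ->
  derives H (atom (compr A) ts).
Proof. by move=> wA d; apply: d_conv d (conv_sym (conv_compr _ _)) _. Qed.

(** Every comprehension over an atom [P y] is therefore well-formed. *)
Lemma occ_idvars a n : n < size a -> occ_tms n (idvars a).
Proof.
rewrite /idvars.
suff gen : forall (b : arity) G (f : ren b G) k,
    (forall r (i : ix b r), pos (f r i) = k + pos i) ->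
    n < size b -> occ_tms (k + n) (varlist f).
  by apply: (gen a a _ 0).
move=> {a} b; elim: b n => //= r b IH [|n] G f k fk nb.
  by rewrite (fk r ix0) /= eqxx.
rewrite addnS -addSn (IH n _ _ k.+1) ?orbT // => s i.
by rewrite fk /= addnS.
Qed.

Lemma wf_compr a (A : formula [::] a) :
  (forall n, n < size a -> occ n A) -> wf A -> wf_pred (compr A).
Proof.
by move=> oA /= ->; rewrite andbT; apply/allP => n; rewrite mem_iota => /oA.
Qed.

Lemma wf_cap a (P Q : predicate [::] a) :
  wf_pred P -> wf_pred Q -> wf_pred (cap P Q).
Proof.
move=> wP wQ; apply: wf_compr => [n na|]; last by rewrite /= wP wQ.
by rewrite /= occ_idvars.
Qed.

Lemma wf_cup a (P Q : predicate [::] a) :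
  wf_pred P -> wf_pred Q -> wf_pred (cup P Q).
Proof.
move=> wP wQ; apply: wf_compr => [n na|]; last by rewrite /= wP wQ.
by rewrite /= occ_idvars.
Qed.

Lemma capE G (H : seq (formula [::] G)) a (P Q : predicate [::] a) ts :
  wf_pred P -> wf_pred Q -> derives H (atom (cap P Q) ts) ->
  derives H (atom P ts) /\ derives H (atom Q ts).
Proof.
move=> wP wQ /comprE /=; rewrite tmssub_idvars wP wQ => /(_ isT) d.
by split; [apply: cnjE1 d|apply: cnjE2 d].
Qed.

Lemma cupI2 G (H : seq (formula [::] G)) a (P Q : predicate [::] a) ts :
  wf_pred P -> wf_pred Q -> derives H (atom Q ts) ->
  derives H (atom (cup P Q) ts).
Proof.
move=> wP wQ d; apply: comprI; first exact: wf_cup.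
by rewrite /= tmssub_idvars; apply: dsjI2.
Qed.

Lemma wf_clause_form G a (P Q : predicate [::] a) c :
  wf_pred P -> wf_pred Q -> wf_clause c -> wf (clause_form G P Q c).
Proof.
move=> wP wQ wc; rewrite wf_alls wf_fren; apply: wf_foldr_imp => //.
by apply: wfs_map => A /wc wA; apply: wf_pinst.
Qed.

Lemma wf_included G a (P : predicate [::] a) B :
  wf_pred P -> wf B -> wf (included G P B).
Proof. by move=> wP wB; rewrite wf_alls /= wf_fsub wP. Qed.

Lemma clause_formI G (H : seq (formula [::] G)) a (P Q : predicate [::] a) c :
  wf_pred P -> wf_clause c ->
  derives [seq pinst P A | A <- cprems c] (atom Q (cargs c)) ->
  derives H (clause_form G P Q c).
Proof.
move=> wP wc d; apply/allsI_closed/foldr_impI; last by rewrite cats0.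
by apply: wfs_map => A /wc wA; apply: wf_pinst.
Qed.

Lemma clause_formE G (H : seq (formula [::] G)) a (P Q : predicate [::] a) c
    (us : sub (cvars c) G) :
  derives H (clause_form G P Q c) ->
  (forall A, List.In A (cprems c) -> derives H (fsub (pinst P A) us)) ->
  derives H (atom Q (tmssub (cargs c) us)).
Proof.
move/(allsE_closed us); rewrite fsub_foldr_imp => d dA.
apply: foldr_impE d _ => B; rewrite -map_comp => BIn.
by have [A AIn ->] := in_mapP BIn; apply: dA.
Qed.

Lemma includedI G (H : seq (formula [::] G)) a (P : predicate [::] a) B :
  wf_pred P -> derives [:: atom P (idvars a)] B -> derives H (included G P B).
Proof. by move=> wP d; apply/allsI_closed/d_impI. Qed.

Lemma includedE G (H : seq (formula [::] G)) a (P : predicate [::] a) B ts :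
  derives H (included G P B) -> derives H (atom P ts) ->
  derives H (fsub B (look ts)).
Proof.
move/(allsE_closed (look ts)) => /=; rewrite tmssub_idvars; exact: d_impE.
Qed.

Lemma subpE G (H : seq (formula [::] G)) a (P Q : predicate [::] a) ts :
  derives H (subp G P Q) -> derives H (atom P ts) -> derives H (atom Q ts).
Proof. by move=> d /(includedE d) /=; rewrite tmssub_idvars. Qed.

Lemma mu_intro G (H : seq (formula [::] G)) a (K : clauses [::] a) c
    (us : sub (cvars c) G) :
  wf_clauses K -> List.In c (clist K) ->
  (forall A, List.In A (cprems c) -> derives H (fsub (pinst (mu K) A) us)) ->
  derives H (atom (mu K) (tmssub (cargs c) us)).
Proof.
move=> wK cK; apply: clause_formE; apply: d_ax; first exact: ax_mu.
by apply: wf_clause_form => //; apply: wf_clauses_clist cK.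
Qed.

(** In the step, the variables of the clause form the whole context and its
premises are the only hypotheses, because [P] has no free term variables: a
statement with parameters has to quantify over them inside [P]. *)
Lemma mu_ind G (H : seq (formula [::] G)) a (K : clauses [::] a) P ts :
  wf_clauses K -> wf_pred P ->
  (forall c, List.In c (clist K) ->
     derives [seq pinst (cap (mu K) P) A | A <- cprems c] (atom P (cargs c))) ->
  derives H (atom (mu K) ts) -> derives H (atom P ts).
Proof.
move=> wK wP step; apply: subpE.
have wc c : List.In c (clist K) -> wf_clause c by apply: wf_clauses_clist.
have wcap : wf_pred (cap (mu K) P) by apply: wf_cap.
have ax := ax_ind G K P.
apply: (foldr_impE (d_ax H ax _)).
  apply: wf_foldr_imp; last exact: wf_included.
  by apply: wfs_map => c /wc ?; apply: wf_clause_form.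
move=> B BIn; have [c cK ->] := in_mapP BIn.
by apply: clause_formI; auto.
Qed.

Lemma wf_Phi a (K : clauses [::] a) P :
  wf_clauses K -> wf_pred P -> wf (Phi K P).
Proof.
move=> wK wP; apply/wf_bigor/wfs_map => c /(wf_clauses_clist wK) wc.
rewrite wf_exs /= wf_eqsf; apply/wf_bigand/wfs_map => A /wc wA.
by rewrite wf_fren wf_pinst.
Qed.

Lemma nu_unfold G (H : seq (formula [::] G)) a (K : clauses [::] a) ts :
  wf_clauses K -> derives H (atom (nu K) ts) ->
  derives H (fsub (Phi K (nu K)) (look ts)).
Proof.
move=> wK; apply: includedE; apply: d_ax; first exact: ax_nu.
by apply: wf_included => //; apply: wf_Phi.
Qed.

Lemma nu_coind G (H : seq (formula [::] G)) a (K : clauses [::] a) Q ts :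
  wf_clauses K -> wf_pred Q ->
  derives [:: atom Q (idvars a)] (Phi K (cup (nu K) Q)) ->
  derives H (atom Q ts) -> derives H (atom (nu K) ts).
Proof.
move=> wK wQ step; apply: subpE; apply: d_impE (includedI _ wQ step).
apply: d_ax; first exact: ax_coind.
rewrite /= !wf_included //; apply: wf_Phi => //; exact: wf_cup.
Qed.

(** * Finite conjunctions and disjunctions, Leibniz equality *)

Lemma eqf_refl G (H : seq (formula [::] G)) r (t : tm G r) :
  derives H (eqf _ t t).
Proof.
pose xx : tms [:: r] [:: r; r] := tcons (var ix0) (tcons (var ix0) tnil).
have := @mu_intro G H _ (ccons pnil xx cnil) (@Clause [::] _ _ [::] xx)
  (look (tcons t tnil)) isT (or_introl erefl).
by apply.
Qed.

Lemma bigandI G (H : seq (formula [::] G)) As : wfs As ->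
  (forall A, List.In A As -> derives H A) -> derives H (bigand As).
Proof.
elim: As => [|A As IH]; first by move=> _ _; apply: eqf_refl.
move=> /wfs_cons [wA wAs] dA.
have {IH} : derives H (bigand As) by apply: IH => // B BAs; apply: dA; right.
have := wf_bigand wAs; have := dA _ (or_introl erefl).
by case: As {wAs dA} => [|B As] //= *; apply: cnjI.
Qed.

Lemma bigandE G (H : seq (formula [::] G)) As A : wfs As ->
  derives H (bigand As) -> List.In A As -> derives H A.
Proof.
elim: As => [|B As IH] // /wfs_cons [wB wAs] d.
have [dB dAs] : derives H B /\ (As <> [::] -> derives H (bigand As)).
  have := wf_bigand wAs; case: As d {IH wAs} => [|C As] //= d wAs.
  by split; [apply: cnjE1 d|move=> _; apply: cnjE2 d].
by case=> [<- //|AAs]; apply: IH => //; apply: dAs => eA; rewrite eA in AAs.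
Qed.

Lemma bigorI G (H : seq (formula [::] G)) As A : wfs As ->
  List.In A As -> derives H A -> derives H (bigor As).
Proof.
elim: As => [|B As IH] // /wfs_cons [wB wAs] AAs dA.
have := wf_bigor wAs; case: As IH wAs AAs => [|C As] IH wAs.
  by case=> [->|].
case=> [e|AAs] wA.
  by subst B; apply: (dsjI1 wB wA).
by apply: (dsjI2 wB wA); apply: IH.
Qed.

(** The conclusion [bot] also covers the empty disjunction, which is [bot]
itself and from which minimal logic does not give an arbitrary conclusion. *)
Lemma bigorE_bot G (H : seq (formula [::] G)) As : wfs As ->
  derives H (bigor As) ->
  (forall A, List.In A As -> derives (A :: H) (bot _ _)) ->
  derives H (bot _ _).
Proof.
elim: As H => [|B As IH] H // /wfs_cons [wB wAs] d dA.
have := wf_bigor wAs; case: As IH wAs d dA => [|C As] IH wAs d dA w.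
  by apply: derives_cut d (dA _ (or_introl erefl)).
apply: (dsjE wB w _ d) => //; first exact: dA (or_introl erefl).
apply: IH => //; first exact: derives_hyp0.
move=> A AAs; apply: derives_incl (dA _ (or_intror AAs)) _.
by apply: incl_cons1 => E; right.
Qed.

(** Leibniz induction on the predicate {x, y | y = x}. *)
Lemma eqf_sym G (H : seq (formula [::] G)) r (t u : tm G r) :
  derives H (eqf _ t u) -> derives H (eqf _ u t).
Proof.
pose A : formula [::] [:: r; r] := eqf _ (var (ixS r ix0)) (var ix0).
have wA : wf_pred (compr A) by [].
move=> d; suff : derives H (atom (compr A) (tcons t (tcons u tnil))).
  exact: comprE.
apply: mu_ind d => // c [<-|] //=; apply: comprI => //; exact: eqf_refl.
Qed.

Lemma wfs_eqlist D G a (ts us : tms G a) : wfs (eqlist D ts us).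
Proof. elim: ts us => [|r b t ts IH] us //= A [<- //|]; exact: IH. Qed.

Lemma eqsfI G (H : seq (formula [::] G)) a (ts us : tms G a) :
  (forall r i, derives H (eqf _ (look ts i) (look us i : tm G r))) ->
  derives H (eqsf _ ts us).
Proof.
move=> d; apply: bigandI; first exact: wfs_eqlist.
elim: ts us d => [|r b t ts IH] us //=.
rewrite (tms_cons us) /= => d A [<-|]; first exact: d ix0.
by apply: IH => s i; apply: d (ixS r i).
Qed.

Lemma eqsfE G (H : seq (formula [::] G)) a (ts us : tms G a) :
  derives H (eqsf _ ts us) ->
  forall r i, derives H (eqf _ (look ts i) (look us i : tm G r)).
Proof.
move=> d; have {d} := fun A => bigandE (A := A) (@wfs_eqlist _ _ _ ts us) d.
elim: ts us => [|r b t ts IH] us; first by move=> _; apply: ix_case0.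
rewrite (tms_cons us) /= => d.
apply: (ix_caseS (P := fun s i => derives H (eqf _ (look (tcons t ts) i)
   (look (tcons (thd us) (ttl us)) i)))) => [|s i].
  by apply: d; left.
by apply: IH => A AIn; apply: d; right.
Qed.

Lemma eqsf_sym G (H : seq (formula [::] G)) a (ts us : tms G a) :
  derives H (eqsf _ ts us) -> derives H (eqsf _ us ts).
Proof. by move/eqsfE => d; apply: eqsfI => r i; apply: eqf_sym. Qed.

(** * One unfolding of a coinductive predicate *)

Lemma tmssub_ixr X a G (us : sub X G) (ts : tms G a) :
  tmssub (varlist (fun _ => @ixr _ X a _)) (scat (F := tm G) us (look ts)) = ts.
Proof. by apply: tmssub_varlist => r i; rewrite scat_ixr. Qed.

Lemma PhiI G (H : seq (formula [::] G)) a (K : clauses [::] a) P c ts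
    (us : sub (cvars c) G) :
  wf_clauses K -> wf_pred P -> List.In c (clist K) ->
  derives H (eqsf _ ts (tmssub (cargs c) us)) ->
  (forall A, List.In A (cprems c) -> derives H (fsub (pinst P A) us)) ->
  derives H (fsub (Phi K P) (look ts)).
Proof.
move=> wK wP cK deq dA; have wc := wf_clauses_clist wK cK.
have wAs : forall A, List.In A (cprems c) -> wf (pinst P A).
  by move=> A /wc; apply: wf_pinst.
rewrite fsub_bigor; apply: bigorI.
- apply: wfs_map => B BIn; rewrite wf_fsub; have [d dK ->] := in_mapP BIn.
  rewrite wf_exs /= wf_eqsf; apply/wf_bigand/wfs_map => A AIn.
  by rewrite wf_fren wf_pinst //; apply: (wf_clauses_clist wK dK).
- by apply/in_mapI/in_mapI; apply: cK.
rewrite fsub_exs; apply: (exsI (us := us)).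
  rewrite /= !wf_fsub wf_eqsf; apply/wf_bigand/wfs_map => A AIn.
  by rewrite wf_fren wAs.
rewrite fsub_fsub upn_scat /= fsub_eqsf tmssub_ixr tmssub_tmssub ixl_scat.
have wB : wfs [seq fsub A us | A <- [seq pinst P A | A <- cprems c]].
  rewrite -map_comp; apply: wfs_map => A AIn; rewrite /= wf_fsub; exact: wAs.
rewrite fsub_bigand -map_comp.
rewrite (eq_map (g := (fun A => fsub A us) \o (pinst P))); last first.
  by move=> A; rewrite /= /fren fsub_fsub ixl_scat.
rewrite map_comp; apply: cnjI => //; [exact: wf_eqsf|exact: wf_bigand|].
apply: bigandI => // B; rewrite -map_comp => BIn.
by have [A AIn ->] := in_mapP BIn; apply: dA.
Qed.

(** The inverse of [PhiI] for the conclusion [bot]: the variables of the clause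
extend the context.  The hypotheses [Hs] are left abstract, since only the facts
that they derive matter. *)
Lemma PhiE G (H : seq (formula [::] G)) a (K : clauses [::] a) P ts :
  wf_clauses K -> wf_pred P -> derives H (fsub (Phi K P) (look ts)) ->
  (forall c, List.In c (clist K) ->
   forall Hs, List.incl (map (fren (fun _ => @ixr _ (cvars c) G _)) H) Hs ->
     derives Hs (eqsf _ (tmssub ts (vsub (fun _ => @ixr _ (cvars c) G _)))
       (tmssub (cargs c) (vsub (fun _ => @ixl _ (cvars c) G _)))) ->
     (forall A, List.In A (cprems c) ->
        derives Hs (fren (fun _ => @ixl _ (cvars c) G _) (pinst P A))) ->
     derives Hs (bot _ _)) ->
  derives H (bot _ _).
Proof.
move=> wK wP; rewrite fsub_bigor => d dc; apply: bigorE_bot d _.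
  apply: wfs_map => B BIn; rewrite wf_fsub; have [c cK ->] := in_mapP BIn.
  rewrite wf_exs /= wf_eqsf; apply/wf_bigand/wfs_map => A AIn.
  by rewrite wf_fren wf_pinst //; apply: (wf_clauses_clist wK cK).
move=> B; rewrite -map_comp => BIn; have [c cK -> /=] := in_mapP BIn.
rewrite fsub_exs /= fsub_eqsf fsub_bigand -map_comp.
rewrite tmssub_tmssub upn_ixl.
pose g A := fren (fun _ => @ixl _ (cvars c) G _) (pinst P A).
rewrite (eq_map (g := g)); last by move=> A; rewrite /= /fren fsub_fsub upn_ixl.
have -> : tmssub (varlist (fun _ => @ixr _ (cvars c) a _))
    (upn (cvars c) (look ts)) =
    tmssub ts (vsub (fun _ => @ixr _ (cvars c) G _)).
  apply: tmssub_varlist => r i.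
  rewrite look_tmssub -upn_ixr; by [].
set E := eqsf _ _ _; set As := map _ _.
have wE : wf E by apply: wf_eqsf.
have wAs : wfs As.
  apply: wfs_map => A AIn; rewrite wf_fren wf_pinst //.
  exact: (wf_clauses_clist wK cK).
have wA := wf_bigand wAs.
apply: (exsE (A := cnj E (bigand As)) _ _ (derives_hyp0 _ _)) => //=.
  by rewrite wE wA.
apply: (dc c cK); first by move=> C CIn; do 2 right.
- by apply: cnjE1 (derives_hyp0 _ _).
- move=> A AIn; apply: (bigandE wAs); first exact: cnjE2 (derives_hyp0 _ _).
  exact: (in_mapI (fun A => fren _ (pinst P A))).
Qed.

(** * Falsity and equality of arbitrary terms *)

Lemma nonunif_loop r (r' : type) (j : ix [:: r] r') (i i' : 'I_1) :
  unifiable (lnil r') (lnil r') -> i = i'.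
Proof. by rewrite (ord1 i) (ord1 i'). Qed.

(** The single rule D := D; it inhabits every type with a closed term. *)
Definition loop_block (r : type) : block :=
  @Block 0 [:: r] (fun r' _ => r') (fun _ _ => 1) (fun _ _ _ => [::])
    (fun r' _ _ => lnil r') (@nonunif_loop r).

Definition undef G r : tm G r :=
  @prog G (loop_block r) (fun _ j _ => var (ixl [::] j)) r ix0.

Definition undefs X G : sub X G := fun r _ => undef G r.

(** If-then-else on [boole], with the rules D ff x y := x and D tt x y := y. *)
Definition cond_type (r : type) : type := arr boole (arr r (arr r r)).

(** [b] selects the constructor [tt], the second one of [boole_cons]. *)
Definition cond_lhs r (b : bool) : lhs (cond_type r) r [:: r; r] :=
  lcons (pcon (if b return ix boole_cons [::] then ixS [::] ix0 else ix0)
      patnil)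
    (lcons (pvar r) (lcons (pvar r) (lnil r))).

Definition cond_lhss r r' (j : ix [:: cond_type r] r') (i : 'I_2) :
    lhs r' r [:: r; r] :=
  scons (F := fun r' => 'I_2 -> lhs r' r [:: r; r])
    (fun i => cond_lhs r (i != ord0))
    (fun r' j => ixnil (F := fun r' => 'I_2 -> lhs r' r [:: r; r]) j) j i.

Lemma cond_nonunif r r' (j : ix [:: cond_type r] r') (i i' : 'I_2) :
  unifiable (cond_lhss j i) (cond_lhss j i') -> i = i'.
Proof.
move: r' j; apply: (ix_caseS (P := fun r' j =>
  unifiable (cond_lhss j i) (cond_lhss j i') -> i = i')); last first.
  exact: (ix_case0 (fun _ k => unifiable (cond_lhss (ixS (cond_type r) k) i)
    (cond_lhss (ixS (cond_type r) k) i') -> i = i')).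
case=> th [th' /= [e _ _]]; apply/val_inj.
by case: i i' e => [[|[|i]] iP] [[|[|i']] iP'].
Qed.

Definition cond_block (r : type) : block :=
  @Block 0 [:: cond_type r] (fun _ _ => r) (fun _ _ => 2)
    (fun _ _ _ => [:: r; r]) (@cond_lhss r) (@cond_nonunif r).

Definition cond G r (b : tm G boole) (t u : tm G r) : tm G r :=
  app (app (app (@prog G (cond_block r)
    (fun _ _ i => var (ixS (cond_type r)
       (if i == ord0 :> 'I_2 then ix0 else ixS r ix0)))
    (cond_type r) ix0) b) t) u.

Lemma cond_ff G r (t u : tm G r) : teq (cond (bff G) t u) t.
Proof.
exact: (@teq_comp G (cond_block r) _ (cond_type r) ix0 ord0
  (look (tcons t (tcons u tnil)))).
Qed.

Lemma cond_tt G r (t u : tm G r) : teq (cond (btt G) t u) u.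
Proof.
exact: (@teq_comp G (cond_block r) _ (cond_type r) ix0 ord_max
  (look (tcons t (tcons u tnil)))).
Qed.

Definition conds G a (b : tm G boole) (f g : sub a G) : tms G a :=
  tmssub (idvars a) (fun _ i => cond b (f _ i) (g _ i)).

Lemma conds_sub G H a (b : tm G boole) (f g : sub a G) (h : sub G H) :
  tmssub (conds b f g) h = conds (tsub b h) (subc f h) (subc g h).
Proof. by rewrite /conds tmssub_tmssub. Qed.

Lemma tmseq_varlist a G H (h : ren a G) (f g : sub G H) :
  (forall r i, teq (f r i) (g r i)) ->
  tmseq (tmssub (varlist h) f) (tmssub (varlist h) g).
Proof. by move=> fg; elim: a h => [|r a IH] h /=; constructor. Qed.

Lemma conds_ff G a (f g : sub a G) :
  tmseq (conds (bff G) f g) (tmssub (idvars a) f).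
Proof. apply: tmseq_varlist => r i; exact: cond_ff. Qed.

Lemma conds_tt G a (f g : sub a G) :
  tmseq (conds (btt G) f g) (tmssub (idvars a) g).
Proof. apply: tmseq_varlist => r i; exact: cond_tt. Qed.

(** As [bot] is the equality of false and true, Leibniz induction on
{b, c | for all xs and ys, P (cond b xs ys) implies P (cond c xs ys)} leads from
[ts] to [us].  The quantifiers over xs and ys are needed because [ts] and [us]
may not occur as parameters of the comprehension. *)
Lemma bot_transport G (H : seq (formula [::] G)) a (P : predicate [::] a)
    ts us :
  wf_pred P -> derives H (bot _ _) ->
  derives H (atom P ts) -> derives H (atom P us).
Proof.
move=> wP dbot dts.
pose bb : ctx := [:: boole; boole].
pose G' : ctx := (a ++ a) ++ bb.
pose b : tm G' boole := var (ixr (a ++ a) (ix0 : ix bb boole)).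
pose c : tm G' boole := var (ixr (a ++ a) (ixS boole ix0 : ix bb boole)).
pose xs : sub a G' := fun _ i => var (ixl bb (ixl a i)).
pose ys : sub a G' := fun _ i => var (ixl bb (ixr a i)).
pose B : formula [::] G' := atom P (conds b xs ys) ⊃ atom P (conds c xs ys).
(* The equation makes b and c occur even if the arity [a] is empty. *)
pose R : formula [::] bb :=
  cnj (eqf _ (var ix0) (var (ixS boole ix0))) (alls (X := a ++ a) B).
have wR : wf R by rewrite /= wf_alls /= wP.
have wcR : wf_pred (compr R) by apply: wf_compr => // [[|[|n]]].
have : derives H (atom (compr R) (tcons (bff G) (tcons (btt G) tnil))).
  apply: mu_ind dbot => // e [<-|//] /=; apply: comprI => //.
  rewrite [fsub _ _]/=; apply: cnjI; rewrite ?wf_fsub ?wf_alls /= ?wP //.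
    exact: eqf_refl.
  rewrite fsub_alls; apply: (allsI (X := a ++ a)) => /=; apply: d_impI => //.
  rewrite !conds_sub.
  set h := upn _ _.
  have -> : tsub c h = tsub b h; last exact: derives_hyp0.
  rewrite -[LHS]/(subc (vsub (fun _ => @ixr _ (a ++ a) bb _)) h
    (ixS boole ix0)).
  by rewrite -[RHS]/(subc (vsub (fun _ => @ixr _ (a ++ a) bb _)) h ix0) upn_ixr.
move=> /(comprE wR); rewrite [fsub _ _]/= => /cnjE2.
rewrite wf_fsub wf_alls /= wP => /(_ isT isT).
rewrite fsub_alls => /(allsE (scat (F := tm G) (look ts) (look us))).
rewrite fsub_fsub upn_scat /= !conds_sub /=.
set h := scat _ _.
have -> : subc xs h = look ts.
  by apply: ix_fun_ext => r i; rewrite /subc /= /h !scat_ixl.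
have -> : subc ys h = look us.
  by apply: ix_fun_ext => r i; rewrite /subc /= /h scat_ixl scat_ixr.
rewrite /h !scat_ixr /= => d.
have dff : conv (atom P ts) (atom P (conds (bff G) (look ts) (look us))).
  apply: conv_sym; apply: conv_atom; first exact: pconv_refl.
  by have := conds_ff (look ts) (look us); rewrite tmssub_idvars.
have dtt : conv (atom P (conds (btt G) (look ts) (look us))) (atom P us).
  apply: conv_atom; first exact: pconv_refl.
  by have := conds_tt (look ts) (look us); rewrite tmssub_idvars.
by apply: (d_conv _ dtt wP); apply: d_impE d _; apply: d_conv dts dff wP.
Qed.

Lemma bot_eqf G (H : seq (formula [::] G)) r (t u : tm G r) :
  derives H (bot _ _) -> derives H (eqf _ t u).
Proof. by move=> d; apply: bot_transport d (eqf_refl H t). Qed.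

Lemma bot_eqsf G (H : seq (formula [::] G)) a (ts us : tms G a) :
  derives H (bot _ _) -> derives H (eqsf _ ts us).
Proof. by move=> d; apply: eqsfI => r i; apply: bot_eqf. Qed.

(** * Ex falso *)

Definition explosive a (P : predicate [::] a) : Prop :=
  forall G (H : seq (formula [::] G)) ts,
    derives H (bot _ _) -> derives H (atom P ts).

Lemma derives_bot_wk G r (H : seq (formula [::] G)) :
  derives H (bot _ _) -> derives (map (@wk _ _ r) H) (bot _ _).
Proof. by move/derives_fsub => /(_ _ (vsub (fun _ => ixS r))). Qed.

(** The hypothesis is used at the single assumption [bot], which no substitution
changes. *)
Lemma explosive_inst X G (H : seq (formula [::] G)) (A : formula [::] X)
    (us : sub X G) :
  (forall H', derives H' (bot _ _) -> derives H' A) ->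
  derives H (bot _ _) -> derives H (fsub A us).
Proof.
move=> dA d; apply: (derives_cut _ d) => //.
have := derives_fsub (dA [:: bot _ _] (derives_hyp0 _ _)) us.
by move=> /= d'; apply: derives_incl d' _ => B [<-|//]; left.
Qed.

Lemma cat_nil (T : Type) (s t : seq T) : s ++ t = [::] -> s = [::] /\ t = [::].
Proof. by case: s. Qed.

Lemma pocc_prems_plist n D G (ps : prems D G) A :
  List.In A (plist ps) -> pocc n A -> pocc_prems n ps.
Proof.
elim: ps A => //= {}D {}G B ps IH A [->|AIn] oA; first by rewrite oA.
by rewrite (IH _ AIn oA) orbT.
Qed.

Lemma pocc_clist n D a (K : clauses D a) c :
  List.In c (clist K) -> forall A, List.In A (cprems c) -> pocc n.+1 A ->
  pocc_clauses n K.
Proof.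
elim: K c => //= {}D {}a G ps ts K IH c [<-|cK] A AIn oA.
  by rewrite (pocc_prems_plist AIn oA).
by rewrite (IH _ cK A AIn oA) orbT.
Qed.

Lemma hasN_in (T : Type) (p : pred T) (l : seq T) x :
  ~~ has p l -> List.In x l -> p x = false.
Proof.
by elim: l => //= y l IH; case py: (p y) => //= /IH {}IH [<-|/IH].
Qed.

Lemma look_idvars a : look (idvars a) = @var a.
Proof. exact: look_varlist. Qed.

Definition explosive_form D G (A : formula D G) : Prop :=
  forall s : psub D [::], wf_psub s ->
  (forall b i, pocc (pos i) A -> explosive (s b i)) ->
  forall H, derives H (bot _ _) -> derives H (form_sub A s).

(** Only the bound variables that occur have to be instantiated by explosive
predicates.  This matters for an inductive predicate that is inhabited because
of a clause whose premises do not mention the bound variable: it is instantiated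
by that very predicate, about which nothing is known yet. *)
Lemma ex_falso :
  (forall D a (P : predicate D a), wf_pred P -> inh_pred P ->
     PP_pred P = [::] ->
     forall s : psub D [::], wf_psub s ->
     (forall b i, pocc_pred (pos i) P -> explosive (s b i)) ->
     explosive (pred_sub P s)) /\
  (forall D G (A : formula D G), wf A -> inh A -> PP A = [::] ->
     explosive_form A) /\
  (forall D G (ps : prems D G), wf_prems ps -> inh_prems ps ->
     PP_prems ps = [::] ->
     forall A, List.In A (plist ps) -> explosive_form A) /\
  (forall D a (K : clauses D a), wf_clauses K -> inh_clauses K ->
     PP_clauses K = [::] ->
     forall c, List.In c (clist K) ->
     forall A, List.In A (cprems c) -> explosive_form A).
Proof.
apply: syntax_ind => //=.
- by move=> D a i _ _ _ s ws es; apply: es.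
- move=> D a A IH wA iA pA s ws es G H ts d; apply: comprI.
    exact: (@wf_pred_sub _ _ (compr A)).
  case/andP: wA => _ wA; apply: explosive_inst d => H'.
  by apply: IH => // b i /es.
- move=> D a K IH wK [iK iK'] pK s ws es G H ts d.
  have wI : wf_pred (pred_sub (mu K) s) by apply: wf_pred_sub.
  (* An inhabitant given in a context G0 is closed by [undef]. *)
  case: iK => [[G0 [ts0 /(_ s ws) /(derives_inst H (@undefs G0 G))]]|[c cK oc]].
    exact: bot_transport d.
  have cK' : List.In (clause_sub c (upps s)) (clist (clauses_sub K s)).
    by rewrite clist_sub; apply: (in_mapI (fun c => clause_sub c (upps s))).
  apply: (bot_transport _ wI d (mu_intro (us := @undefs _ G) wI cK' _)).
  move=> B BIn; have [A AIn ->] := in_mapP BIn; rewrite pinst_upps.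
  apply: explosive_inst d; apply: (IH wK iK' pK c cK A AIn).
    exact: wf_scons.
  apply: (ix_caseS (P := fun b i => pocc (pos i) A ->
    explosive (scons (mu (clauses_sub K s)) s i))) => [|b i] /= oA.
    by rewrite (hasN_in oc AIn) in oA.
  by apply: es; apply: (pocc_clist cK AIn oA).
- move=> D a K IH wK iK pK s ws es G H ts d.
  set K' := clauses_sub K s; set J := nu K'.
  have wK' : wf_clauses K' by apply: (proj2 (proj2 (proj2 wf_sub))).
  (* Q is equivalent to [bot]; the trivial implication makes all y occur. *)
  pose Jy : formula [::] a := atom J (idvars a).
  pose Q := compr (cnj (Jy ⊃ Jy) (bot _ a)).
  have wQ : wf_pred Q.
    by apply: wf_compr => [n na|]; rewrite /= ?occ_idvars // wK'.
  have eQ : explosive Q.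
    move=> G' H' us d'; apply: comprI => //=; apply: cnjI => //=.
      by rewrite wK'.
    by apply: d_impI => //; apply: derives_hyp0.
  have eJQ : explosive (cup J Q).
    by move=> G' H' us d'; apply: cupI2 => //; apply: eQ.
  have wJQ : wf_pred (cup J Q) by apply: wf_cup.
  apply: nu_coind (eQ _ _ _ d) => //.
  have : derives [:: atom Q (idvars a)] (bot _ _).
    have /comprE /= := derives_hyp0 [::] (atom Q (idvars a)).
    by rewrite wK' => /(_ isT) /cnjE2 /=; rewrite wK'; apply.
  move: [:: _] => H0 d0; rewrite -(fsub_var (Phi _ _)) -look_idvars.
  (* Without clauses the operator is [bot]; otherwise the first clause serves,
     as all equations and, by induction, all premises follow from [bot]. *)
  case eK : (clist K) => [|c l].
    by rewrite /Phi clist_sub eK.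
  have cK : List.In c (clist K) by rewrite eK; left.
  have cK' : List.In (clause_sub c (upps s)) (clist K').
    by rewrite clist_sub; apply: (in_mapI (fun c => clause_sub c (upps s))).
  apply: (PhiI (us := @undefs _ a) wK' wJQ cK'); first exact: bot_eqsf.
  move=> B BIn; have [A AIn ->] := in_mapP BIn; rewrite pinst_upps.
  apply: explosive_inst d0; apply: (IH wK iK pK c cK A AIn).
    exact: wf_scons.
  apply: (ix_caseS (P := fun b i => pocc (pos i) A ->
    explosive (scons (cup J Q) s i))) => [|b i] //= oA.
  by apply: es; apply: (pocc_clist cK AIn oA).
- by move=> D G a P IH ts wP iP pP s ws es H d; apply: IH.
- move=> D G A _ B IH /andP [wA wB] [iA iB] pB s ws es H d.
  by apply: d_impI wA _; apply: IH => //; apply: derives_cons.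
- move=> D G A IHA B IHB /andP [wA wB] [iA iB] /cat_nil [pA pB] s ws es H d.
  apply: cnjI; [exact: wf_form_sub|exact: wf_form_sub| |].
    by apply: IHA => // b i oA; apply: es; rewrite /= oA.
  by apply: IHB => // b i oB; apply: es; rewrite /= oB orbT.
- move=> D G A IHA B IHB /andP [wA wB] [iA iB] /cat_nil [pA pB] s ws es H d.
  apply: dsjI1; [exact: wf_form_sub|exact: wf_form_sub|].
  by apply: IHA => // b i oA; apply: es; rewrite /= oA.
- move=> D G r A IH wA iA pA s ws es H d.
  by apply: d_allI; apply: IH => //; apply: derives_bot_wk.
- move=> D G r A IH wA iA pA s ws es H d.
  apply: (ex1I (t := undef G r)); first exact: wf_form_sub.
  by apply: explosive_inst d => H'; apply: IH.
- move=> D G A IHA ps IHps /andP [wA wps] [iA ips] /cat_nil [pA pps] B [<-|].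
    exact: IHA.
  exact: IHps.
- move=> D a G ps IHps ts K IHK /andP [wps wK] [ips iK] /cat_nil [pps pK].
  by move=> c [<-|cK] /=; [apply: IHps|apply: IHK].
Qed.

Corollary ex_falso_form G (A : formula [::] G) (H : seq (formula [::] G)) :
  tcf_formula A -> PP A = [::] -> derives H (bot _ _) -> derives H A.
Proof.
case=> wA iA pA d; rewrite -(form_sub0 A (@pbd [::])).
apply: (proj1 (proj2 ex_falso)) d => //.
by move=> b; apply: (ix_case0 (fun b i => _ -> explosive (pbd i))).
Qed.

(** * Contradiction between a formula and its strong negation *)

Definition incompatible a (P Q : predicate [::] a) : Prop :=
  forall G (H : seq (formula [::] G)) ts,
    derives H (atom P ts) -> derives H (atom Q ts) -> derives H (bot _ _).

(** A formula and its strong negation share their bound predicate variables, but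
[s] instantiates those of the former and [s'] those of the latter. *)
Definition incompatible_form D G (A : formula D G) : Prop :=
  forall s s' : psub D [::], wf_psub s -> wf_psub s' ->
  (forall b i, incompatible (s b i) (s' b i)) ->
  forall H, derives H (form_sub A s) -> derives H (form_sub (negf A) s') ->
    derives H (bot _ _).

Lemma incompatible_inst X G (H : seq (formula [::] G)) (A B : formula [::] X)
    (us : sub X G) :
  wf A -> wf B ->
  (forall H', derives H' A -> derives H' B -> derives H' (bot _ _)) ->
  derives H (fsub A us) -> derives H (fsub B us) -> derives H (bot _ _).
Proof.
move=> wA wB dAB dA dB.
have d : derives [:: A; B] (bot _ _).
  exact: dAB (derives_hyp0 _ _) (derives_hyp1 _ _ _).
have {}d := derives_fsub d us.
apply: (derives_cut _ dB); first by rewrite wf_fsub.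
apply: (derives_cut _ (derives_cons _ dA)); first by rewrite wf_fsub.
by apply: derives_incl d _ => C /= [<-|[<-|//]]; [left|right; left].
Qed.

Lemma allE_var G r (H : seq (formula [::] G)) (A : formula [::] (r :: G)) :
  derives H (all1 A) -> derives (map (@wk _ _ r) H) A.
Proof.
move/derives_fsub => /(_ _ (vsub (fun _ => ixS r))) /= /(d_allE (var ix0)).
by rewrite fsub_fsub ups_wk_sub1 fsub_var.
Qed.

Lemma incompatible_scons D a (P Q : predicate [::] a) (s s' : psub D [::]) :
  incompatible P Q -> (forall b i, incompatible (s b i) (s' b i)) ->
  forall b i, incompatible (scons (F := predicate [::]) P s (x := b) i)
    (scons (F := predicate [::]) Q s' i).
Proof.
move=> PQ ss; exact: (ix_caseS (P := fun b i =>
  incompatible (scons (F := predicate [::]) P s i)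
    (scons (F := predicate [::]) Q s' i))).
Qed.

(** The conjunct of [c] in the defining formula of the strong negation, applied
to the equations between its argument list and the conclusion of [c]. *)
Lemma neg_clauseE D a (K : clauses D a) (s : psub (a :: D) [::]) c
    G (H : seq (formula [::] G)) (us : sub a G) (vs : sub (cvars c) G) :
  wf_clauses K -> wf_psub s -> List.In c (clist K) ->
  derives H (fsub (form_sub (bigand (negE K)) s) us) ->
  derives H (eqsf _ (tmssub (idvars a) us) (tmssub (cargs c) vs)) ->
  derives H (bigor [seq fsub (form_sub (negf A) s) vs | A <- cprems c]).
Proof.
move=> wK ws cK; rewrite negE_clist form_sub_bigand fsub_bigand -!map_comp.
move=> dE; set h := (X in map X (clist K)) in dE.
have : derives H (h c).
  apply: bigandE dE _; last exact: in_mapI.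
  apply: wfs_map => e eK; rewrite /h /= wf_fsub.
  apply: wf_form_sub => //; apply: wf_neg_clause.
  exact: (wf_negf_clist wK eK).
rewrite /h /= /neg_clause form_sub_alls fsub_alls /= => /(allsE vs) /=.
rewrite !fsub_eqsf form_sub_fsub !fsub_fsub !tmssub_tmssub !upn_scat !ixl_scat.
rewrite form_sub_bigor fsub_bigor -!map_comp => d deq; apply: d_impE d _.
have -> : tmssub (varlist (fun _ => @ixr _ (cvars c) a _))
    (scat (F := tm G) vs us) = tmssub (idvars a) us; last exact: deq.
apply: tmssub_varlist => r i; by rewrite scat_ixr look_idvars_sub.
Qed.

(** The common core of the cases mu and nu: one side provides a clause with all
of its premises, the other side the defining formula of the strong negation,
which contradicts one of these premises. *)
Lemma incompatible_clause D a (K : clauses D a) (s s' : psub (a :: D) [::]) c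
    G (H : seq (formula [::] G)) (us : sub a G) (vs : sub (cvars c) G) :
  wf_clauses K -> wf_psub s -> wf_psub s' ->
  (forall b i, incompatible (s b i) (s' b i)) ->
  List.In c (clist K) ->
  (forall A, List.In A (cprems c) -> incompatible_form A) ->
  derives H (fsub (form_sub (bigand (negE K)) s') us) ->
  derives H (eqsf _ (tmssub (idvars a) us) (tmssub (cargs c) vs)) ->
  (forall A, List.In A (cprems c) -> derives H (fsub (form_sub A s) vs)) ->
  derives H (bot _ _).
Proof.
move=> wK ws ws' ss cK IH dE deq dA.
have wc := wf_clauses_clist wK cK.
have wn A : List.In A (cprems c) -> wf (form_sub (negf A) s').
  move=> AIn; apply: wf_form_sub => //.
  exact: (wf_negf_clist wK cK).
apply: bigorE_bot (neg_clauseE wK ws' cK dE deq) _.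
  by apply: wfs_map => A AIn; rewrite wf_fsub; apply: wn.
move=> B BIn; have [A AIn ->] := in_mapP BIn.
apply: (incompatible_inst (A := form_sub A s) (B := form_sub (negf A) s')
  (us := vs)).
- by apply: wf_form_sub => //; apply: wc.
- exact: wn.
- by move=> H'; apply: IH.
- by apply/derives_cons/dA.
- exact: derives_hyp0.
Qed.

(** Of a mu or nu and its strong negation, one is inductive and the other
coinductive: induction shows that the inductive one refutes the other, which is
unfolded in the induction step. *)
Lemma contradiction :
  (forall D a (P : predicate D a), wf_pred P -> PP_pred P = [::] ->
     forall s s' : psub D [::], wf_psub s -> wf_psub s' ->
     (forall b i, incompatible (s b i) (s' b i)) ->
     incompatible (pred_sub P s) (pred_sub (negp P) s')) /\
  (forall D G (A : formula D G), wf A -> PP A = [::] ->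
     incompatible_form A) /\
  (forall D G (ps : prems D G), wf_prems ps -> PP_prems ps = [::] ->
     forall A, List.In A (plist ps) -> incompatible_form A) /\
  (forall D a (K : clauses D a), wf_clauses K -> PP_clauses K = [::] ->
     forall c, List.In c (clist K) ->
     forall A, List.In A (cprems c) -> incompatible_form A).
Proof.
apply: syntax_ind => //=.
- move=> D a A IH /andP [_ wA] pA s s' ws ws' ss G H ts.
  move=> /comprE dA /comprE dB.
  have wsA : wf (form_sub A s) by apply: wf_form_sub.
  have wnA : wf (form_sub (negf A) s') := wf_form_sub (wf_negf wA) ws'.
  apply: (incompatible_inst wsA wnA _ (dA wsA) (dB wnA)) => H'; exact: IH.
- move=> D a K IH wK pK s s' ws ws' ss G H ts.
  set I := mu _; set L := ccons _ _ _; set N := nu L.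
  have wI : wf_pred I by apply: (@wf_pred_sub _ _ (mu K)).
  have wN : wf_pred N.
    by apply: (@wf_pred_sub _ _ (negp (mu K))) => //; apply: (proj1 wf_neg).
  pose P : predicate [::] a := compr (atom N (idvars a) ⊃ bot _ a).
  have wP : wf_pred P.
    apply: wf_compr => [n na|]; first by rewrite /= occ_idvars.
    by rewrite /=; move: wN => /= ->.
  suff step : derives H (atom I ts) -> derives H (atom P ts).
    move=> /step /comprE; rewrite [wf _]/=; move: wN => /= -> /(_ isT).
    by rewrite /= tmssub_idvars; apply: d_impE.
  apply: mu_ind => // c'; rewrite clist_sub => cIn.
  have [c cK ->] := in_mapP cIn.
  apply: comprI => //; rewrite /= tmssub_idvars; apply: d_impI => //.
  have /nu_unfold := derives_hyp0 [seq pinst (cap I P) A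
    | A <- cprems (clause_sub c (upps s))] (atom N (cargs c)).
  move=> /(_ wN) /(PhiE (wN : wf_clauses L) wN); apply.
  (* The single clause of N has the variables y of its conclusion as cargs. *)
  move=> e [<-|//] Hs inc deq.
  move=> /(_ _ (or_introl erefl)).
  rewrite pinst_upps -/(fren _ _) => dE.
  apply: (incompatible_clause (K := K)
    (s := scons (F := predicate [::]) (cap I P) s)
    (s' := scons (F := predicate [::]) N s') wK _ _ _ cK _ dE (eqsf_sym deq) _).
  + exact: wf_scons (wf_cap wI wP) ws.
  + exact: wf_scons wN ws'.
  + apply: incompatible_scons => // G' H' us dcap dN.
    have [_ /comprE] := capE wI wP dcap.
    rewrite [wf _]/=; move: wN => /= -> /(_ isT).
    by rewrite /= tmssub_idvars => d; apply: d_impE d dN.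
  + exact: IH wK pK c cK.
  + move=> A AIn; rewrite -pinst_upps.
    apply/d_hyp/inc/(in_mapI (fren (fun _ => @ixr _ a (cvars c) _))); right.
    apply: (in_mapI (pinst (cap I P))).
    exact: (in_mapI (fun A => form_sub A (upps s))).
- move=> D a K IH wK pK s s' ws ws' ss G H ts.
  set J := nu _; set L := ccons _ _ _; set M := mu L => dJ dM.
  have wJ : wf_pred J by apply: (@wf_pred_sub _ _ (nu K)).
  have wM : wf_pred M.
    by apply: (@wf_pred_sub _ _ (negp (nu K))) => //; apply: (proj1 wf_neg).
  pose P : predicate [::] a := compr (atom J (idvars a) ⊃ bot [::] a).
  have wJf : wf (atom J (idvars a) ⊃ bot [::] a).
    by rewrite /=; move: wJ => /= ->.
  have wP : wf_pred P.
    by apply: wf_compr => [n na|//]; rewrite /= occ_idvars.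
  have compP G' (H' : seq (formula [::] G')) us :
      derives H' (atom P us) -> derives H' (atom J us) -> derives H' (bot _ _).
    by move=> /(comprE wJf); rewrite /= tmssub_idvars; apply: d_impE.
  apply: (compP _ _ _ _ dJ); apply: mu_ind dM => // e [<-|//].
  rewrite [cargs _]/= [cvars _]/= [cprems _]/= [map _ _]/= pinst_upps.
  set E := form_sub _ _.
  apply: comprI => //; rewrite look_idvars fsub_var; apply: d_impI => //.
  have /nu_unfold := derives_hyp0 [:: E] (atom J (idvars a)).
  move=> /(_ wJ) /(PhiE (wJ : wf_clauses (clauses_sub K s)) wJ); apply.
  move=> c'; rewrite clist_sub => cIn.
  have [c cK ->] := in_mapP cIn => Hs inc deq dA.
  have dE : derives Hs (fsub E (vsub (fun _ => @ixr _ (cvars c) a _))).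
    apply/d_hyp/inc/(in_mapI (fren (fun _ => @ixr _ (cvars c) a _))).
    by right; left.
  apply: (incompatible_clause (K := K) (s := scons (F := predicate [::]) J s)
    (s' := scons (F := predicate [::]) (cap M P) s') wK _ _ _ cK _ dE deq _).
  + exact: wf_scons wJ ws.
  + exact: wf_scons (wf_cap wM wP) ws'.
  + apply: incompatible_scons => // G' H' us dJ' dcap.
    by have [_ /compP] := capE wM wP dcap; apply.
  + exact: IH wK pK c cK.
  + move=> A AIn; rewrite -pinst_upps; apply: dA.
    exact: (in_mapI (fun A => form_sub A (upps s))).
- by move=> D G a P IH ts wP pP s s' ws ws' ss H; apply: IH.
- move=> D G A _ B IH /andP [wA wB] pB s s' ws ws' ss H dAB /=.
  have wB' : wf (form_sub (negf B) s') := wf_form_sub (wf_negf wB) ws'.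
  rewrite form_ren0_sub => dn; have dA := cnjE1 wA wB' dn.
  by apply: (IH wB pB s s' ws ws' ss); [apply: d_impE dAB dA|apply: cnjE2 dn].
- move=> D G A IHA B IHB /andP [wA wB] /cat_nil [pA pB] s s' ws ws' ss H d dn.
  have wA' := wf_form_sub wA ws; have wB' := wf_form_sub wB ws.
  have wnA := wf_form_sub (wf_negf wA) ws'.
  have wnB := wf_form_sub (wf_negf wB) ws'.
  apply: (dsjE wnA wnB _ dn) => //.
    apply: (IHA wA pA s s' ws ws' ss); last exact: derives_hyp0.
    by apply: derives_cons; apply: cnjE1 d.
  apply: (IHB wB pB s s' ws ws' ss); last exact: derives_hyp0.
  by apply: derives_cons; apply: cnjE2 d.
- move=> D G A IHA B IHB /andP [wA wB] /cat_nil [pA pB] s s' ws ws' ss H d dn.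
  have wA' := wf_form_sub wA ws; have wB' := wf_form_sub wB ws.
  have wnA := wf_form_sub (wf_negf wA) ws'.
  have wnB := wf_form_sub (wf_negf wB) ws'.
  apply: (dsjE wA' wB' _ d) => //.
    apply: (IHA wA pA s s' ws ws' ss); first exact: derives_hyp0.
    by apply: derives_cons; apply: cnjE1 dn.
  apply: (IHB wB pB s s' ws ws' ss); first exact: derives_hyp0.
  by apply: derives_cons; apply: cnjE2 dn.
- move=> D G r A IH wA pA s s' ws ws' ss H d dn.
  have wnA := wf_form_sub (wf_negf wA) ws'.
  apply: (ex1E wnA _ dn) => //.
  apply: (IH wA pA s s' ws ws' ss); last exact: derives_hyp0.
  exact/derives_cons/allE_var.
- move=> D G r A IH wA pA s s' ws ws' ss H d dn.
  have wA' := wf_form_sub wA ws.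
  apply: (ex1E wA' _ d) => //.
  apply: (IH wA pA s s' ws ws' ss); first exact: derives_hyp0.
  exact/derives_cons/allE_var.
- move=> D G A IHA ps IHps /andP [wA wps] /cat_nil [pA pps] B [<-|].
    exact: IHA.
  exact: IHps.
- move=> D a G ps IHps ts K IHK /andP [wps wK] /cat_nil [pps pK].
  by move=> c [<-|cK] /=; [apply: IHps|apply: IHK].
Qed.

Corollary contradiction_form G (A : formula [::] G) (H : seq (formula [::] G)) :
  wf A -> PP A = [::] -> derives H A -> derives H (negf A) ->
  derives H (bot _ _).
Proof.
move=> wA pA; rewrite -{1}(form_sub0 A (@pbd [::])).
rewrite -(form_sub0 (negf A) (@pbd [::])).
apply: (proj1 (proj2 contradiction)) => //.
by move=> b; apply: (ix_case0 (fun b i => incompatible (pbd i) (pbd i))).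
Qed.

(** * Universal closures and relative tightness *)

Lemma close_intro G (A : formula [::] G) : ⊢ A -> ⊢ close A.
Proof. by elim: G A => //= r G IH A d; apply/IH/d_allI. Qed.

Lemma close_elim G (A : formula [::] G) : ⊢ close A -> ⊢ A.
Proof. by elim: G A => //= r G IH A /IH /allE_var. Qed.

Lemma close_iff G (A : formula [::] G) : ⊢ close A <-> ⊢ A.
Proof. by split; [apply: close_elim|apply: close_intro]. Qed.

(** The nested implication [imps], over an arbitrary list of indices, so that it
can be decomposed one premise at a time. *)
Definition premises (T : Type) G (C : T -> formula [::] G) (l : seq T)
    (B : formula [::] G) : formula [::] G :=
  foldl (fun B j => C j ⊃ B) B l.

Lemma premises_iff (T : Type) G (C : T -> formula [::] G) l B H :
  (forall j, wf (C j)) ->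
  derives H (premises C l B) <-> derives (map C l ++ H) B.
Proof.
move=> wC; elim: l B H => //= j l IH B H; rewrite IH; split.
- move=> d; apply: (@d_impE _ _ (C j)); last exact: derives_hyp0.
  exact: derives_cons.
- by move=> d; apply: d_impI.
Qed.

Lemma imps_iff G (C : 'I_(size G) -> formula [::] G) B :
  (forall j, wf (C j)) ->
  ⊢ close (imps C B) <-> derives (map C (enum 'I_(size G))) B.
Proof. by move=> wC; rewrite close_iff (premises_iff _ _ _ wC) cats0. Qed.

(** The strong negation of [A] at some [x] implies the existential formula
[negf (all1 A)]; so refuting the latter refutes the former everywhere. *)
Lemma tight_all1 G r (A : formula [::] (r :: G)) :
  wf A -> tight A -> tight (all1 A).
Proof.
move=> wA tA; have wN : wf (negf A) by apply: wf_negf.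
apply: d_impI; first by rewrite /= wN.
apply: d_allI; apply: d_impE (derives_weak _ tA) _; apply: d_impI => //.
apply: (@d_impE _ _ (wk r (ex1 (negf A)))).
  by apply: d_hyp; right; left.
rewrite -[wk r (ex1 (negf A))]/(ex1 (fsub (negf A)
  (ups (vsub (fun _ => ixS r))))).
apply: (ex1I (t := var ix0)); first by rewrite wf_fsub.
by rewrite fsub_fsub ups_wk_sub1 fsub_var; apply: derives_hyp0.
Qed.

Lemma tight_close G (A : formula [::] G) : wf A -> tight A -> tight (close A).
Proof.
by elim: G A => //= r G IH A wA tA; apply: IH => //; apply: tight_all1.
Qed.

(** Given the premise [C j], the strong negation of [B] implies that of
[C j ⊃ B]. *)
Lemma tight_premises (T : Type) G (C : T -> formula [::] G) l B :
  (forall j, wf (C j)) -> wf B ->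
  ⊢ premises C l (neg (negf B) ⊃ B) ->
  tight (premises C l B).
Proof.
move=> wC wB; elim: l B wB => //= j l IH B wB.
move=> tB; have wBn : wf (negf B) by apply: wf_negf.
apply: IH; rewrite /= ?wC //; move: tB; rewrite !(premises_iff _ _ _ wC) => tB.
have e : form_ren (C j) (fun a => ixnil (F := ix [::]) (x := a)) = C j.
  rewrite -[RHS](form_ren0_sub (C j) (fun a => ixnil (F := ix [::]) (x := a))
    (@pbd [::])).
  by rewrite form_sub0.
have wN : wf (neg (cnj (C j) (negf B))) by rewrite /= wC wBn.
rewrite e; apply: d_impI => //; apply: d_impI => //.
apply: (@d_impE _ _ (neg (negf B))); last first.
  apply: d_impI => //; apply: (@d_impE _ _ (cnj (C j) (negf B))).
    by apply: d_hyp; right; right; left.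
  by apply: cnjI => //; [apply: derives_hyp1|apply: derives_hyp0].
apply: (@d_impE _ _ (C j)); last exact: derives_hyp0.
by do 2 apply: derives_cons.
Qed.

Theorem proposition5p5 (G : ctx) (A : formula [::] G)
    (C : 'I_(size G) -> formula [::] G)
    (n_gt0 : 0 < size G)
    (A_formula : tcf_formula A) (C_formula : forall j, tcf_formula (C j))
    (A_vars : forall j : 'I_(size G), occ j A)
    (C_vars : forall i j : 'I_(size G), occ i (C j) = (i == j))
    (A_PP : PP A = [::]) :
  [/\ ⊢ close (imps C (dsj A (negf A))) -> tight_rel C A,
      tight_rel C A -> ⊢ close (imps C (neg (neg A) ⊃ A))
    & tight_rel C A -> tight (close (imps C A))].
Proof.
have wA : wf A by case: A_formula.
have wC j : wf (C j) by case: (C_formula j).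
have wN : wf (negf A) by apply: wf_negf.
have wnN : wf (neg (negf A)) by rewrite /= wN.
have wnnA : wf (neg (neg A)) by rewrite /= wA.
rewrite /tight_rel; split; rewrite !(imps_iff _ wC).
- move=> d; apply: d_impI => //.
  apply: (dsjE wA wN wA (derives_cons _ d)); first exact: derives_hyp0.
  apply: ex_falso_form => //.
  by apply: d_impE (derives_hyp1 _ _ _) (derives_hyp0 _ _).
- move=> t; apply: d_impI => //; apply: d_impE (derives_cons _ t) _.
  apply: d_impI => //; apply: d_impE (derives_hyp1 _ _ _) _.
  apply: d_impI => //; apply: contradiction_form wA A_PP _ _.
    exact: derives_hyp0.
  exact: derives_hyp1.
- move=> t; apply: tight_close.
    rewrite /imps.
    elim: (enum _) A wA {A_formula A_vars A_PP wN wnN wnnA t} => //=.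
    by move=> j l IH B wB; apply: IH; rewrite /= wC.
  by apply: tight_premises => //; apply/(premises_iff _ _ _ wC); rewrite cats0.
Qed.
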